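(* Let $W$ be one of $W_H$, $W_L$, $W_J$, with $W=T\widetilde WT^*$ as in the context, and let $D=T(x)\big(\partial^2\rho(x)+\partial\,(\widetilde W(x)\rho(x))'\widetilde W(x)^{-1}+\widetilde K\big)T(x)^{-1}$, where $K=\sum_{j=1}^{\lfloor N/2\rfloor}E_{2j,2j}$ and $\widetilde K=2K$, $K$, $(\alpha_1+\beta_1)K$ in the Hermite, Laguerre, Jacobi case respectively. Then $D$ is a second-order operator in $\mathcal D(W)$ and $\mathcal D(W)=\mathbb C[D]$, i.e. every operator in $\mathcal D(W)$ is a polynomial in $D$.
   Context: Classical scalar weights: Hermite $w_b(x)=e^{-x^2+2bx}$ on $\mathbb R$; Laguerre $w_\alpha(x)=e^{-x}x^\alpha$ on $(0,\infty)$, $\alpha>-1$; Jacobi $w_{\alpha,\beta}(x)=(1-x)^\alpha(1+x)^\beta$ on $(-1,1)$, $\alpha,\beta>-1$; $\rho(x)=1$, $x$, $1-x^2$ in the Hermite, Laguerre, Jacobi cases. Let $N\ge2$, $A=\sum_{j=1}^{\lfloor N/2\rfloor}a_{2j-1}E_{2j-1,2j}+\sum_{j=1}^{\lfloor (N-1)/2\rfloor}a_{2j}E_{2j+1,2j}$ ($E_{s,t}$ matrix units, all $a_j\in\mathbb R\setminus\{0\}$), $T(x)=I+Ax$. $W_H=T\widetilde W_HT^*$ with $\widetilde W_H=\mathrm{diag}(w_{b_1},\dots,w_{b_N})$, $b_i$ pairwise distinct reals; $W_L=T\widetilde W_LT^*$ with $\widetilde W_L=\mathrm{diag}(w_{\alpha_1},\dots,w_{\alpha_N})$,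 $\alpha_i-\alpha_j\notin\mathbb Z$ for $i\ne j$; $W_J=T\widetilde W_JT^*$ with $\widetilde W_J=\mathrm{diag}(w_{\alpha_1,\beta_1},\dots,w_{\alpha_N,\beta_N})$, where for $i\ne j$, $\alpha_i-\alpha_j\notin\mathbb Z$ or $\beta_i-\beta_j\notin\mathbb Z$, and $\alpha_1+\beta_1=\alpha_j+\beta_j+1+(-1)^j$ for all $j$. Differential operators act on the right: $P\cdot\sum_j\partial^jF_j=\sum_j\partial^j(P)F_j$; $T\mathcal BT^{-1}$ denotes composition with multiplication operators. For a weight matrix $W$ with monic orthogonal polynomials $P_n$ (w.r.t. $\langle P,Q\rangle=\int PWQ^*dx$), $\mathcal D(W)$ is the algebra of differential operators with matrix polynomial coefficients such that $P_n\cdot D=\Lambda_n(D)P_n$ for all $n\ge0$ with constant matrices $\Lambda_n(D)$. *)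

(* Defs.v *)
From HB Require Import structures.
From mathcomp Require Import all_boot all_order all_algebra.
From mathcomp Require Import all_classical all_reals all_analysis.
From mathcomp Require Import complex.
Set Implicit Arguments. Unset Strict Implicit. Unset Printing Implicit Defensive.
Import Order.TTheory GRing.Theory Num.Theory.
Local Open Scope classical_set_scope.
Local Open Scope ring_scope.

Section Defs.
Variable R : realType.
Local Notation C := (complex R).

(* A = sum_j a_{2j-1} E_{2j-1,2j} + sum_j a_{2j} E_{2j+1,2j}  (1-based).
   In 0-based indices (i,j): the nonzero entries are at (c-1,c) with value a_c
   and at (c+1,c) with value a_{c+1}, for c odd; i.e. value a_{max(i,j)}. *)
Definition Amx (N : nat) (a : nat -> R) : 'M[R]_N :=
  \matrix_(i, j) (if odd j && ((i.+1 == j) || (i == j.+1 :> nat))%N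
                  then a (maxn i j) else 0).

(* K = sum_j E_{2j,2j} (1-based) : diagonal 1 at odd 0-based positions. *)
Definition Kmx (N : nat) : 'M[R]_N := \matrix_(i, j) ((i == j) && odd i)%:R.

Definition Tpoly N (A : 'M[R]_N) : 'M[{poly R}]_N := 1%:M + 'X *: map_mx polyC A.
Definition Tfun N (A : 'M[R]_N) (x : R) : 'M[R]_N := 1%:M + x *: A.

(* W(x) = T(x) diag(w_1(x),...,w_N(x)) T(x)^*   (T real, so T^* = T^T) *)
Definition Wfun N (A : 'M[R]_N) (w : 'I_N -> R -> R) (x : R) : 'M[R]_N :=
  Tfun A x *m diag_mx (\row_i w i x) *m (Tfun A x)^T.

Definition mxpeval N (P : 'M[{poly R}]_N) (x : R) : 'M[R]_N :=
  map_mx (fun p => p.[x]) P.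

Definition mx_monic_deg N (n : nat) (P : 'M[{poly R}]_N) : Prop :=
  forall i j, (size (P i j - ((i == j)%:R *: 'X^n))%R <= n)%N.

(* P is a sequence of monic orthogonal polynomials for the weight W on I:
   P n is monic of degree n and <P n, x^k E_{ij}> = int_I P_n W x^k = 0 for k<n
   (equivalently P n is orthogonal to every matrix polynomial of degree < n). *)
Definition monic_OPS N (W : R -> 'M[R]_N) (I : set R)
    (P : nat -> 'M[{poly R}]_N) : Prop :=
  forall n, mx_monic_deg n (P n) /\
    forall k, (k < n)%N -> forall i j,
      (@lebesgue_measure R).-integrable I
         (fun x => (((mxpeval (P n) x *m W x) i j * x ^+ k)%:E)) /\
      (\int[@lebesgue_measure R]_(x in I)
         (((mxpeval (P n) x *m W x) i j * x ^+ k)%:E) = 0)%E.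

Definition RtoC (r : R) : C := Complex r 0.
Definition mxpC N (P : 'M[{poly R}]_N) : 'M[{poly C}]_N :=
  map_mx (map_poly RtoC) P.

(* D = sum_j d^j F_j is represented by its coefficient list [:: F_0; F_1; ...] *)
Definition dop N := seq 'M[{poly C}]_N.

Definition dact N (P : 'M[{poly C}]_N) (D : dop N) : 'M[{poly C}]_N :=
  \sum_(j < size D) map_mx (fun p => p^`(j)) P *m D`_j.

Definition dop_order2 N (D : dop N) : Prop :=
  D`_2 != 0 /\ forall j, (2 < j)%N -> D`_j = 0.

Definition in_DW N (W : R -> 'M[R]_N) (I : set R) (D : dop N) : Prop :=
  forall P : nat -> 'M[{poly R}]_N, monic_OPS W I P ->
  forall n, exists L : 'M[C]_N,
    dact (mxpC (P n)) D = map_mx polyC L *m mxpC (P n).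

Definition dact_poly N (q : {poly C}) (D : dop N) (F : 'M[{poly C}]_N)
  : 'M[{poly C}]_N :=
  \sum_(k < size q) (q`_k)%:P *: iter k (fun G => dact G D) F.

(* B = d^2 (rho I) + d F1 + Ktilde, with F1 = (Wtilde rho)' Wtilde^{-1}
   diagonal with entries f1 i, and Ktilde = kt * K *)
Definition Bop N (rho : {poly R}) (f1 : 'I_N -> {poly R}) (kt : R) : dop N :=
  [:: mxpC (map_mx polyC (kt *: Kmx N));
      mxpC (diag_mx (\row_i f1 i));
      mxpC (rho%:M)].

Definition thm_conclusion N (A : 'M[R]_N) (w : 'I_N -> R -> R) (I : set R)
    (rho : {poly R}) (f1 : 'I_N -> {poly R}) (kt : R) : Prop :=
  let W := Wfun A w in
  let TC := mxpC (Tpoly A) in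
  exists D : dop N,
    (forall F : 'M[{poly C}]_N,
        dact F D = dact (F *m TC) (Bop rho f1 kt) *m invmx TC) /\
    dop_order2 D /\
    in_DW W I D /\
    (forall D' : dop N, in_DW W I D' ->
       exists q : {poly C}, forall F, dact F D' = dact_poly q D F).

Definition w_hermite (b x : R) : R := expR (- x ^+ 2 + 2 * b * x).
Definition w_laguerre (al x : R) : R := expR (- x) * powR x al.
Definition w_jacobi (al be x : R) : R := powR (1 - x) al * powR (1 + x) be.

Definition rho_hermite : {poly R} := 1.
Definition rho_laguerre : {poly R} := 'X.
Definition rho_jacobi : {poly R} := 1 - 'X ^+ 2.

(* (w rho)'/w, computed:  Hermite 2b - 2x;  Laguerre (al+1) - x;
   Jacobi (be - al) - (al + be + 2) x *)
Definition f1_hermite (b : R) : {poly R} := (2 * b)%:P - 2%:P * 'X.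
Definition f1_laguerre (al : R) : {poly R} := (al + 1)%:P - 'X.
Definition f1_jacobi (al be : R) : {poly R} :=
  (be - al)%:P - (al + be + 2)%:P * 'X.

End Defs.

(* Main.v *)
(** Each scalar weight is replaced by its moment functional [L i p = int p w_i],
    of which only two facts matter: positivity, and the Pearson equation
    [L i (rho h' + f1 h) = 0].  If [D'] belongs to [D(W)], then so does its adjoint
    for the form [sum_l L l ((fT)_l (gT)_l)], and so [E = T^-1 D' T] and its adjoint
    act on polynomials.  An off-diagonal entry of [E] forces a relation
    [u L_i = v L_j] between polynomial multiples of two functionals, which the
    Pearson equations exclude, hence [E] is diagonal.  Its entries [E_i] do not
    raise degrees, and the off-diagonal entries of [D' = T E T^-1] not raising
    degrees either means that the eigenvalues satisfy [mu_j (n+1) = mu_i n] for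
    neighbours [i], [j].  The classical operators [delta_i + kappa_i] satisfy the
    same relation, so once [mu_0 = q(lambda_0)] for a polynomial [q], the operator
    [E_i - q(delta_i + kappa_i)] strictly lowers degrees for every [i]; having an
    adjoint that does not raise degrees, it vanishes. *)
Require Import Defs.
From HB Require Import structures.
From mathcomp Require Import all_boot all_order all_algebra.
From mathcomp Require Import all_classical all_reals all_analysis.
From mathcomp Require Import complex.
From mathcomp Require Import measurable_realfun ring lra zify.
Import Order.TTheory GRing.Theory Num.Theory numFieldNormedType.Exports.
Set Implicit Arguments.
Unset Strict Implicit.
Unset Printing Implicit Defensive.
Local Open Scope classical_set_scope.
Local Open Scope ring_scope.

(** * Functionals satisfying a Pearson equation *)

Section ScalarFunctionals.
Variable F : numFieldType.
Implicit Types (L : {scalar {poly F}}) (f g h u v rho : {poly F}).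

(** The parity pattern of [A] gives [A A = 0], so [T^-1 = 1 - xA] is again polynomial and an entry
    of [T E T^-1] involves at most two diagonal operators. The shift [mu_j (n+1) = mu_i n] is then
    the vanishing of one top coefficient, and [Ktilde] is the constant that makes the classical
    eigenvalues satisfy the same shift. The main obstacle is [mu_0 = q(lambda_0)]. The eigenvalues
    of a differential operator are polynomial in [n]. For Hermite and Laguerre [lambda_0] is a
    nonzero multiple of [n], which is enough. For Jacobi it is quadratic, and few polynomials in [n]
    are polynomials in it: there [E_0] is shown to commute with the classical operator and is
    recovered from values at the end point [1], where every derivative is a polynomial in that
    operator. Membership in [D(W)] is a condition on every orthogonal sequence, so a sequence has to
    be constructed before the condition gives anything. The weights are real and the operators
    complex: over the complex numbers, positivity becomes nondegeneracy, in each bounded degree, of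
    a bilinear form without conjugation. *)

Definition pearson L rho f1 := forall h, L (rho * h^`() + f1 * h) = 0.

(** The test space has the same degree bound as [f]: this is nondegeneracy on each
    finite-dimensional space of bounded degree. Positivity provides it, and it survives
    complexification. *)
Definition nondegenerate L := forall n f, (size f <= n)%N ->
  (forall g, (size g <= n)%N -> L (f * g) = 0) -> f = 0.

Lemma nondegenerate_eq0 L f : nondegenerate L -> (forall g, L (f * g) = 0) -> f = 0.
Proof. by move=> nd Lf; apply: (nd (size f)). Qed.

(* If u L1 = v L2, the two Pearson equations satisfied by this common functional
   differ by multiplication by the polynomial below. *)
Definition ratio_poly rho f1 f2 u v :=
  rho * (u^`() * v - u * v^`()) + (f1 - f2) * (u * v).

(** For weights, [u w1 = v w2] gives [(f1 - f2)/rho = v'/v - u'/u] by logarithmic differentiation,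
    that is, a vanishing [ratio_poly]. *)
Lemma proportional_functionals L1 L2 rho f1 f2 u v :
  nondegenerate L1 -> nondegenerate L2 -> pearson L1 rho f1 -> pearson L2 rho f2 ->
  (forall u v, u != 0 -> v != 0 -> ratio_poly rho f1 f2 u v != 0) ->
  (forall h, L1 (u * h) = L2 (v * h)) -> u = 0 /\ v = 0.
Proof.
move=> nd1 nd2 p1 p2 nz e.
suff uv0 : (u == 0) || (v == 0).
  have eu0 : u = 0 -> v = 0.
    move=> u0; apply: (nondegenerate_eq0 nd2) => g.
    by rewrite -e u0 mul0r linear0.
  have ev0 : v = 0 -> u = 0.
    move=> v0; apply: (nondegenerate_eq0 nd1) => g.
    by rewrite e v0 mul0r linear0.
  by case/orP: uv0 => /eqP z; split=> //; auto.
apply/norP => -[unz vnz]; move: (nz u v unz vnz).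
suff : u * ratio_poly rho f1 f2 u v = 0.
  by move/eqP; rewrite mulf_eq0 (negbTE unz) /= => ->.
apply: (nondegenerate_eq0 nd1) => h.
(* With these test functions the Pearson expressions are multiples of [u] and of [v], with the same
   term [rho u v h'] in the cofactor. It cancels once [L2 (v * _)] is replaced by [L1 (u * _)]. *)
have := p1 (u * u * v * h); have := p2 (v * v * u * h).
rewrite [X in L2 X](_ : _ = v * (rho * (v^`() * u * h *+ 2 + v * u^`() * h +
   u * v * h^`()) + f2 * (u * v * h))); last by rewrite !derivM; ring.
rewrite [X in L1 X](_ : _ = u * (rho * (u^`() * v * h *+ 2 + u * v^`() * h +
   u * v * h^`()) + f1 * (u * v * h))); last by rewrite !derivM; ring.
rewrite -e => e2 e1.
rewrite [X in L1 X](_ : _ =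
  u * (rho * (u^`() * v * h *+ 2 + u * v^`() * h + u * v * h^`()) + f1 * (u * v * h))
  - u * (rho * (v^`() * u * h *+ 2 + v * u^`() * h + u * v * h^`()) + f2 * (u * v * h)));
  last by rewrite /ratio_poly; ring.
by rewrite linearB /= e1 e2 subr0.
Qed.

Lemma sum_represented (I : finType) L (phi : I -> {poly F} -> F) :
  (forall i, exists u, forall f, phi i f = L (f * u)) ->
  exists u, forall f, \sum_i phi i f = L (f * u).
Proof.
move=> /fin_all_exists [u Hu]; exists (\sum_i u i) => f.
by rewrite mulr_sumr linear_sum; apply: eq_bigr.
Qed.

(** The Pearson equation is integration by parts without boundary terms. It removes one derivative
    at the price of one factor [rho], hence [k <= m]. *)
Lemma derivn_represented L rho f1 k m h : pearson L rho f1 -> (k <= m)%N ->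
  exists u, forall f, L ((rho ^+ m * f)^`(k) * h) = L (f * u).
Proof.
move=> pL; elim: k m h => [|k IH] m h km.
  by exists (rho ^+ m * h) => f; rewrite derivn0; congr (L _); ring.
case: m km => // m km; have [u Hu] := IH m h km.
exists (rho^`() *+ m.+1 * u - f1 * u - rho * u^`()) => f.
rewrite derivSn.
have -> : (rho ^+ m.+1 * f)^`() = rho ^+ m * (rho^`() *+ m.+1 * f + rho * f^`()).
  by rewrite derivM deriv_exp exprS /=; ring.
rewrite Hu; have := pL (f * u).
rewrite derivM => e.
rewrite -[LHS]subr0 -[X in _ - X]e -linearB /=; congr (L _); ring.
Qed.

End ScalarFunctionals.

(** * Excluding rational quotients of two classical weights *)

Section RatioPoly.
Variable F : numFieldType.
Implicit Types (f g u v rho sigma : {poly F}).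

Lemma derivXsubCexp (r : F) p f : ('X - r%:P) * (f * ('X - r%:P) ^+ p)^`() =
  ('X - r%:P) ^+ p * (f *+ p + ('X - r%:P) * f^`()).
Proof.
rewrite derivM deriv_exp derivXsubC mul1r; case: p => [|p] /=; last by rewrite exprS; ring.
by rewrite expr0; ring.
Qed.

(* The indicial equation at a root [r] of [rho]. *)
Lemma ratio_poly_root rho sigma f1 f2 (r : F) u v :
  rho = ('X - r%:P) * sigma ->
  (forall z : int, sigma.[r] * z%:~R + (f1.[r] - f2.[r]) != 0) ->
  u != 0 -> v != 0 -> ratio_poly rho f1 f2 u v != 0.
Proof.
move=> -> nz unz vnz.
have [p [u1 /implyP/(_ unz) ru ->]] := multiplicity_XsubC u r.
have [q [v1 /implyP/(_ vnz) rv ->]] := multiplicity_XsubC v r.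
apply/eqP => e.
have : ('X - r%:P) ^+ p * ('X - r%:P) ^+ q *
   (sigma * ((u1 *+ p + ('X - r%:P) * u1^`()) * v1 -
             u1 * (v1 *+ q + ('X - r%:P) * v1^`())) + (f1 - f2) * (u1 * v1)) = 0.
  rewrite -e /ratio_poly.
  have -> (a b c d x s w: {poly F}) : x * s * (a * b - c * d) + w =
     s * ((x * a) * b - c * (x * d)) + w by ring.
  by rewrite !derivXsubCexp; ring.
(* Once the powers of [X - r] are cancelled, the value at [r] is the indicial factor for [z = p - q]
   times [u1.[r] * v1.[r]]. *)
move/eqP; rewrite mulf_eq0 -exprD expf_eq0 polyXsubC_eq0 andbF /= => /eqP.
move/(congr1 (fun w => w.[r])); rewrite !(hornerD, hornerM, hornerN, hornerMn, hornerX, hornerC).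
rewrite subrr !mul0r !addr0 => /eqP.
have -> : sigma.[r] * (u1.[r] *+ p * v1.[r] - u1.[r] * (v1.[r] *+ q)) +
    (f1.[r] - f2.[r]) * (u1.[r] * v1.[r]) =
   (sigma.[r] * (p%:Z - q%:Z)%:~R + (f1.[r] - f2.[r])) * (u1.[r] * v1.[r]).
  by rewrite rmorphB /= -!pmulrn; ring.
rewrite !mulf_eq0 (negbTE (nz _)) /=.
by move: ru rv; rewrite /root => /negbTE -> /negbTE ->.
Qed.

(** For constant [rho] the term with derivatives has smaller degree than [d u v] and cannot cancel
    it. *)
Lemma ratio_poly_const (c d : F) f1 f2 u v : d != 0 -> f1 - f2 = d%:P ->
  u != 0 -> v != 0 -> ratio_poly c%:P f1 f2 u v != 0.
Proof.
move=> dnz e unz vnz; apply/eqP; rewrite /ratio_poly e => /eqP.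
rewrite addr_eq0 => /eqP E.
have uvnz : u * v != 0 by rewrite mulf_neq0.
have su : (size u^`() < size u)%N by rewrite lt_size_deriv.
have sv : (size v^`() < size v)%N by rewrite lt_size_deriv.
have : (size (c%:P * (u^`() * v - u * v^`()) : {poly F})%R < size (u * v)%R)%N.
  rewrite mul_polyC; apply: leq_ltn_trans (size_scale_leq _ _) _.
  apply: leq_ltn_trans (size_polyD _ _) _; rewrite size_polyN gtn_max.
  have v0 : (0 < size v)%N by rewrite size_poly_gt0.
  have u0 : (0 < size u)%N by rewrite size_poly_gt0.
  rewrite (size_mul unz vnz).
  apply/andP; split; apply: leq_ltn_trans (size_polyMleq _ _) _.
    by move: su sv u0 v0; set x := size u; set y := size v; set z := size v^`(); lia.
  by move: su sv u0 v0; set x := size u; set y := size v; set z := size v^`(); lia.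
by rewrite E size_polyN mul_polyC size_scale// ltnn.
Qed.

End RatioPoly.

(** * Triangular operators and their adjoints *)

Section TriangularOperators.
Variable F : numFieldType.
Implicit Types (L : {scalar {poly F}}) (f g h rho q : {poly F}).
Implicit Types (G H : {poly F} -> {poly F}) (mu nu : nat -> F).

(** Stated for bare functions, so that composites and differences of operators qualify as they
    stand. For a linear [G], [mu] is the diagonal of its upper triangular matrix in the monomial
    basis. *)
Definition triangular G mu :=
  forall n f, (size f <= n.+1)%N -> (size (G f - mu n *: f)%R <= n)%N.

Definition adjoint_pair L G H := forall f g, L (G f * g) = L (f * H g).

Lemma triangular0 G mu : triangular G mu -> G 0 = 0.
Proof.
move=> /(_ 0 0); rewrite size_poly0 scaler0 subr0 => /(_ isT).
by rewrite leqn0 size_poly_eq0 => /eqP.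
Qed.

Lemma triangular_leq G mu n f : triangular G mu ->
  (size f <= n)%N -> (size (G f) <= n)%N.
Proof.
move=> tG; case: n => [|n sf].
  by rewrite leqn0 size_poly_eq0 => /eqP ->; rewrite (triangular0 tG) size_poly0.
rewrite -[G f](subrK (mu n *: f)); apply: leq_trans (size_polyD _ _) _.
by rewrite geq_max (leq_trans (tG n f sf)) // (leq_trans (size_scale_leq _ _)).
Qed.

Lemma triangular_coef G mu n : triangular G mu -> (G 'X^n)`_n = mu n.
Proof.
move=> /(_ n 'X^n); rewrite size_polyXn => /(_ (leqnn _)) /leq_sizeP /(_ n (leqnn _)).
by rewrite coefB coefZ coefXn eqxx mulr1 => /eqP; rewrite subr_eq0 => /eqP.
Qed.

Lemma triangular_comp G H mu nu : triangular G mu -> triangular H nu ->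
  triangular (G \o H) (fun n => mu n * nu n).
Proof.
move=> tG tH n f sf /=.
have -> : G (H f) - (mu n * nu n) *: f =
  (G (H f) - mu n *: H f) + mu n *: (H f - nu n *: f).
  by rewrite scalerBr scalerA addrA subrK.
apply: leq_trans (size_polyD _ _) _; rewrite geq_max tG ?(triangular_leq tH)//=.
by apply: leq_trans (size_scale_leq _ _) _; apply: tH.
Qed.

Lemma triangularB G H mu nu : triangular G mu -> triangular H nu ->
  triangular (fun f => G f - H f) (fun n => mu n - nu n).
Proof.
move=> tG tH n f sf /=.
have -> : G f - H f - (mu n - nu n) *: f = (G f - mu n *: f) - (H f - nu n *: f).
  by rewrite -!mul_polyC polyCB; ring.
by apply: leq_trans (size_polyD _ _) _; rewrite size_polyN geq_max tG ?tH.
Qed.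

Lemma triangular_lower G mu n f : triangular G mu -> mu n = 0 ->
  (size f <= n.+1)%N -> (size (G f) <= n)%N.
Proof. by move=> tG mu0 /tG; rewrite mu0 scale0r subr0. Qed.

Lemma linear_triangular (G : {linear {poly F} -> {poly F}}) :
  (forall f, (size (G f) <= size f)%N) -> triangular G (fun n => (G 'X^n)`_n).
Proof.
move=> sG n f sf.
pose f' := f - f`_n *: 'X^n.
have sf' : (size f' <= n)%N.
  apply/leq_sizeP => j; rewrite leq_eqVlt coefB coefZ coefXn => /orP[/eqP <-|nj].
    by rewrite eqxx mulr1 subrr.
  by rewrite gtn_eqF// mulr0 subr0; apply/(leq_sizeP _ _ sf).
have -> : f = f`_n *: 'X^n + f' by rewrite addrC subrK.
rewrite linearD linearZ scalerDr opprD addrACA /=; apply: leq_trans (size_polyD _ _) _.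
rewrite geq_max; apply/andP; split; last first.
  apply: leq_trans (size_polyD _ _) _; rewrite size_polyN geq_max (leq_trans (sG _))//.
  by apply: leq_trans (size_scale_leq _ _) _.
rewrite scalerA mulrC -scalerA -scalerBr; apply: leq_trans (size_scale_leq _ _) _.
apply/leq_sizeP => j; rewrite leq_eqVlt coefB coefZ coefXn => /orP[/eqP <-|nj].
  by rewrite eqxx mulr1 subrr.
rewrite gtn_eqF// mulr0 subr0; apply/(leq_sizeP _ n.+1) => //.
by rewrite (leq_trans (sG _))// size_polyXn.
Qed.

(* By induction on [n], [G] vanishes in degree < n, hence so does its adjoint, and
   [G f] for [f] of degree n is orthogonal to the degrees < n in which it lives. *)
Lemma lowering_adjoint_eq0 L G H : nondegenerate L -> adjoint_pair L G H ->
  triangular G (fun=> 0) -> (forall n g, (size g <= n)%N -> (size (H g) <= n)%N) ->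
  forall f, G f = 0.
Proof.
move=> nd adj tG sH f; move: {2}(size f) (leqnn (size f)) => n.
elim: n f => [|n IH] f sf.
  by move: sf; rewrite leqn0 size_poly_eq0 => /eqP ->; apply: triangular0 tG.
apply: (nd n); first exact: triangular_lower tG _ sf.
move=> g sg; rewrite adj.
suff -> : H g = 0 by rewrite mulr0 linear0.
apply: (nd n); first exact: sH.
by move=> g' sg'; rewrite mulrC -adj IH// mul0r linear0.
Qed.

Definition polyop q G f := \sum_(k < size q) q`_k *: iter k G f.

Lemma polyopE n q G f : (size q <= n)%N ->
  polyop q G f = \sum_(k < n) q`_k *: iter k G f.
Proof.
move=> sq; rewrite /polyop (big_ord_widen n (fun k => q`_k *: iter k G f) sq).
rewrite big_mkcond /=; apply: eq_bigr => k _; case: ltnP => // kq.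
by rewrite nth_default// scale0r.
Qed.

Lemma polyop_is_additive G f p q :
  polyop (p + q) G f = polyop p G f + polyop q G f.
Proof.
pose n := maxn (size p) (size q).
rewrite !(@polyopE n) ?leq_maxl ?leq_maxr ?size_polyD// -big_split /=.
by apply: eq_bigr => k _; rewrite coefD scalerDl.
Qed.

Lemma polyopZ G f c q : polyop (c *: q) G f = c *: polyop q G f.
Proof.
rewrite !(@polyopE (size q)) ?size_scale_leq// scaler_sumr.
by apply: eq_bigr => k _; rewrite coefZ scalerA.
Qed.

Lemma polyopMX G f q : polyop (q * 'X) G f = polyop q G (G f).
Proof.
have sq : (size (q * 'X)%R <= (size q).+1)%N.
  by apply: leq_trans (size_polyMleq _ _) _; rewrite size_polyX addn2.
rewrite (polyopE _ _ sq) big_ord_recl coefMX /= scale0r add0r.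
by apply: eq_bigr => k _; rewrite coefMX -iterS iterSr.
Qed.

Lemma polyop_sum (I : finType) G f (q : I -> {poly F}) :
  polyop (\sum_i q i) G f = \sum_i polyop (q i) G f.
Proof.
apply: (big_morph (fun p => polyop p G f)); first exact: polyop_is_additive.
by rewrite /polyop size_poly0 big_ord0.
Qed.

Lemma triangular_polyop q G mu : triangular G mu ->
  triangular (polyop q G) (fun n => q.[mu n]).
Proof.
move=> tG n f sf.
rewrite horner_coef scaler_suml -sumrB; apply: leq_trans (size_sum _ _ _) _.
apply/bigmax_leqP => k _; rewrite -scalerA -scalerBr.
apply: leq_trans (size_scale_leq _ _) _.
have : triangular (iter k G) (fun n => mu n ^+ k).
  elim: (nat_of_ord k) => [|j IH] m g sg; first by rewrite expr0 scale1r subrr size_poly0.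
  by rewrite exprS; apply: (triangular_comp tG IH).
exact.
Qed.

Lemma polyop_adjoint L q G : adjoint_pair L G G -> adjoint_pair L (polyop q G) (polyop q G).
Proof.
move=> adj f g; rewrite mulr_suml mulr_sumr !linear_sum; apply: eq_bigr => k _.
rewrite -scalerAl -scalerAr !linearZ /=; congr (_ * _).
elim: (nat_of_ord k) f g => //= j IH f g; by rewrite adj IH -iterSr.
Qed.

Lemma polyop_commute q (G : {linear {poly F} -> {poly F}}) f :
  G (polyop q G f) = polyop q G (G f).
Proof.
rewrite linear_sum; apply: eq_bigr => k _; by rewrite linearZ -iterSr.
Qed.

End TriangularOperators.

(** * Classical second-order operators *)

Section SecondOrder.
Variable F : numFieldType.
Implicit Types (L : {scalar {poly F}}) (f g h q : {poly F}).
Variables (rho f1 : {poly F}) (c : F).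

Definition second_order f := rho * f^`(2) + f1 * f^`() + c *: f.

Lemma second_order_is_linear : linear second_order.
Proof.
move=> a f g; rewrite /second_order !linearP /=.
by rewrite -!mul_polyC; ring.
Qed.

HB.instance Definition _ := GRing.isLinear.Build F {poly F} {poly F} _
  second_order second_order_is_linear.

(** Both sides equal [L (c f g - rho f' g')], by the Pearson equation for [f' g] on the left and for
    [f g'] on the right. *)
Lemma second_order_sym L : pearson L rho f1 -> adjoint_pair L second_order second_order.
Proof.
move=> pL f g; have e1 := pL (f^`() * g); have e2 := pL (f * g^`()).
move: e1 e2; rewrite /second_order !derivnS !derivn0 !derivM => e1 e2.
rewrite -[LHS]subr0 -[in LHS]e1 -[RHS]subr0 -[in RHS]e2 -!linearB /=; congr (L _).
by rewrite -!mul_polyC; ring.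
Qed.

Hypotheses (srho : (size rho <= 3)%N) (sf1 : (size f1 <= 2)%N).

Lemma size_second_order f : (size (second_order f) <= size f)%N.
Proof.
have [->|nz] := eqVneq f 0; first by rewrite linear0 size_poly0.
have szf : (0 < size f)%N by rewrite size_poly_gt0.
apply: leq_trans (size_polyD _ _) _; rewrite geq_max size_scale_leq andbT.
apply: leq_trans (size_polyD _ _) _; rewrite geq_max.
have sd g : (size g^`() <= (size g).-1)%N.
  by rewrite (leq_trans (size_poly _ _)).
apply/andP; split; last first.
  apply: leq_trans (size_polyMleq _ _) _; have := sd f; lia.
have [->|fnz] := eqVneq f^`(2) 0; first by rewrite mulr0 size_poly0.
apply: leq_trans (size_polyMleq _ _) _.
have : (0 < size f^`(2))%N by rewrite size_poly_gt0.
have := sd f^`(); have := sd f; rewrite -[f^`()^`()]/(f^`(2)); lia.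
Qed.

Lemma triangular_second_order :
  triangular second_order (fun n => rho`_2 * (n * n.-1)%:R + f1`_1 * n%:R + c).
Proof.
move=> n f sf; have := linear_triangular size_second_order sf.
suff -> : (second_order 'X^n)`_n = rho`_2 * (n * n.-1)%:R + f1`_1 * n%:R + c by [].
rewrite /second_order derivnXn derivXn !coefD coefZ coefXn eqxx mulr1 !mulrnAr !coefMn !mulr1.
congr (_ + _ + _).
  case: n sf => [|[|n]] _; rewrite ?mulr0 ?mulr0n// coefMXn ltnNge.
  by rewrite subn2 /= -[in (n <= n.+2)%N]addn2 leq_addr -[in (n.+2 - n)%N]addn2 addKn ffactnS ffactn1.
case: n sf => [|n] _; rewrite ?mulr0n// coefMXn ltnNge leqnSn /=.
by rewrite subSnn.
Qed.

End SecondOrder.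

(** * Eigenvalues of differential operators as polynomials *)

Section EigenvaluePolynomials.
Variable F : numFieldType.
Implicit Types (L : {scalar {poly F}}) (f g h q : {poly F}) (d : nat -> {poly F}).

Definition diffop m d f := \sum_(k < m) f^`(k) * d k.

Lemma diffop_is_linear m d : linear (diffop m d).
Proof.
move=> a f g; rewrite /diffop scaler_sumr -big_split; apply: eq_bigr => k _ /=.
by rewrite linearP /= mulrDl scalerAl.
Qed.

HB.instance Definition _ m d := GRing.isLinear.Build F {poly F} {poly F} _
  (diffop m d) (diffop_is_linear m d).

Definition falling k : {poly F} := \prod_(j < k) ('X - j%:R%:P).

Lemma falling_horner k n : (falling k).[n%:R] = (n ^_ k)%:R.
Proof.
rewrite /falling; elim: k => [|k IH]; first by rewrite big_ord0 hornerC.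
rewrite big_ord_recr hornerM IH ffactnSr natrM !hornerE.
have [kn|nk] := leqP k n; first by rewrite natrB.
by rewrite ffact_small// !mul0r.
Qed.

(** Since [k] derivatives turn [X^n] into a multiple of [X^(n-k)], only the coefficient of degree
    [k] of [d k] reaches degree [n]. For [k > n] the falling factorial is zero and the term vanishes
    on both sides. *)
Lemma diffop_eigenvalue m d n :
  (diffop m d 'X^n)`_n = (\sum_(k < m) (d k)`_k *: falling k).[n%:R].
Proof.
rewrite coef_sum horner_sum; apply: eq_bigr => k _.
rewrite hornerZ falling_horner derivnXn mulrnAl coefMn mulrC coefMXn mulr_natr.
have [kn|nk] := leqP k n; last by rewrite ffact_small.
by rewrite ltnNge leq_subr /= subKn.
Qed.

(** The eigenvalues are polynomial in [n], and [n] is recovered from [c n]. This settles Hermite and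
    Laguerre, where the classical eigenvalues at index 0 are [-2n] and [-n]. *)
Lemma linear_eigenvalues m d mu c : c != 0 -> triangular (diffop m d) mu ->
  exists q : {poly F}, forall n, mu n = q.[c * n%:R].
Proof.
move=> c0 tE; pose M := \sum_(k < m) (d k)`_k *: falling k.
exists (M \Po (c^-1 *: 'X)) => n; rewrite horner_comp hornerZ hornerX mulKf//.
by rewrite -diffop_eigenvalue -(triangular_coef n tE).
Qed.

Lemma poly_eq_nat (p q : {poly F}) n0 :
  (forall n, (n0 <= n)%N -> p.[n%:R] = q.[n%:R]) -> p = q.
Proof.
move=> e; apply/eqP; rewrite -subr_eq0; apply/eqP.
apply: (@roots_geq_poly_eq0 _ _ [seq i%:R | i <- iota n0 (size (p - q)%R)]).
- rewrite all_map; apply/allP => i; rewrite mem_iota => /andP[n0i _] /=.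
  by rewrite /root hornerD hornerN e// subrr.
- rewrite map_inj_uniq ?iota_uniq// => i j /eqP; rewrite eqr_nat; exact/eqP.
- by rewrite size_map size_iota.
Qed.

Lemma derivn_eq0 (r : F) f : (forall k, f^`(k).[r] = 0) -> f = 0.
Proof.
move=> e; apply/eqP; apply: contraT => nz.
have := e (size f).-1; have -> : f^`((size f).-1) = (lead_coef f *+ (size f).-1`!)%:P.
  apply/polyP => i; rewrite coef_derivn coefC; case: i => [|i] /=.
    by rewrite addn0 ffactnn.
  by rewrite nth_default ?mul0rn// addnS -addSn prednK ?leq_addr// size_poly_gt0.
by rewrite hornerC => /eqP; rewrite -mulr_natr mulf_eq0 lead_coef_eq0 (negbTE nz)
  pnatr_eq0 gtn_eqF// fact_gt0.
Qed.

Section Root.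
Variables (rho f1 : {poly F}) (r : F).
Hypotheses (srho : (size rho <= 3)%N) (sf1 : (size f1 <= 2)%N).
Hypotheses (rhor : rho.[r] = 0) (nz : forall k : nat, k%:R * rho^`().[r] + f1.[r] != 0).
Let delta := second_order rho f1 0.

(** Leibniz rule: the degree bounds make [rho''] and [f1'] constant, so all multiples of the [k]-th
    derivative merge into one scalar. *)
Lemma derivn_second_order k : exists c : F, forall f,
  (delta f)^`(k) = rho * f^`(k.+2) + (k%:R *: rho^`() + f1) * f^`(k.+1) + c *: f^`(k).
Proof.
have deg1 (p : {poly F}) : (size p <= 2)%N -> exists c, p^`() = c%:P.
  move=> sp; exists (p^`()`_0); apply: size1_polyC.
  by apply: leq_trans (size_poly _ _) _; lia.
have [c1 e1] := deg1 f1 sf1.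
have [c2 e2] : exists c, rho^`()^`() = c%:P.
  by apply: deg1; apply: leq_trans (size_poly _ _) _; lia.
elim: k => [|k [c IH]].
  exists 0 => f; rewrite /delta /second_order derivn0 scale0r !scale0r add0r.
  by rewrite derivnS derivn1.
exists (c + k%:R * c2 + c1) => f.
rewrite [LHS]derivnS IH !derivD !derivM derivZ derivD derivZ -!derivnS e1 e2.
by rewrite -!mul_polyC -natr1 !polyCD polyCM; ring.
Qed.

(** At [r] the term with [k+2] derivatives disappears and the coefficient of the next one is nonzero
    by [nz]. The derivative of order [k+1] at [r] is thus obtained from the [k]-th derivatives of
    [delta f] and of [f]. *)
Lemma derivn_at_root k : exists m, forall f, f^`(k).[r] = (polyop m delta f).[r].
Proof.
elim: k => [|k [m Hm]].
  by exists 1 => f; rewrite /polyop size_poly1 big_ord1 coef1 eqxx scale1r.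
have [c Hc] := derivn_second_order k.
exists ((k%:R * rho^`().[r] + f1.[r])^-1 *: (m * 'X - c *: m)) => f.
have := Hm (delta f); rewrite Hc !(hornerD, hornerM, hornerZ) rhor mul0r add0r Hm => e.
rewrite polyopZ polyop_is_additive -scaleNr polyopZ polyopMX hornerZ hornerD hornerZ -e mulNr.
by rewrite addrK mulrA mulVf ?mul1r.
Qed.

(** Products of eigenvalues commute, so the commutator strictly lowers degrees. Its adjoint
    [delta V - V delta] does not raise them, and [lowering_adjoint_eq0] applies. *)
Lemma commutator_eq0 L m d V mu : pearson L rho f1 -> nondegenerate L ->
  triangular (diffop m d) mu -> adjoint_pair L (diffop m d) V ->
  (forall n g, (size g <= n)%N -> (size (V g) <= n)%N) ->
  forall f, diffop m d (delta f) = delta (diffop m d f).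
Proof.
move=> pL nd tE adj sV f; apply/eqP; rewrite -subr_eq0; apply/eqP.
have sd n g : (size g <= n)%N -> (size (delta g) <= n)%N.
  by apply: leq_trans; apply: size_second_order.
have td := triangular_second_order 0 srho sf1.
apply: (@lowering_adjoint_eq0 _ L
  (fun f => diffop m d (delta f) - delta (diffop m d f))
  (fun g => delta (V g) - V (delta g))) => //.
- move=> f' g; rewrite mulrBl mulrBr !linearB /=.
  by rewrite adj !(second_order_sym _ pL) adj.
- move=> n g sg; have := triangularB (triangular_comp tE td) (triangular_comp td tE) sg.
  by rewrite /= mulrC subrr.
- move=> n g sg; apply: leq_trans (size_polyD _ _) _; rewrite size_polyN geq_max.
  by rewrite sd ?sV ?sd.
Qed.

(* Evaluation at [r] turns every derivative into a polynomial in [delta]; an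
   operator commuting with [delta] is then determined by its values at [r]. *)
Lemma root_eigenvalues L m d V mu : pearson L rho f1 -> nondegenerate L ->
  triangular (diffop m d) mu -> adjoint_pair L (diffop m d) V ->
  (forall n g, (size g <= n)%N -> (size (V g) <= n)%N) ->
  exists q, forall n, mu n = q.[rho`_2 * (n * n.-1)%:R + f1`_1 * n%:R].
Proof.
move=> pL nd tE adj sV; have comm := commutator_eq0 pL nd tE adj sV.
have [q Hq] := choice derivn_at_root.
pose Q := \sum_(k < m) (d k).[r] *: q k.
exists Q => n.
have val f : (diffop m d f).[r] = (polyop Q delta f).[r].
  rewrite polyop_sum !horner_sum; apply: eq_bigr => k _.
  by rewrite polyopZ hornerZ hornerM Hq mulrC.
have eqE f : diffop m d f = polyop Q delta f.
  apply/eqP; rewrite -subr_eq0; apply/eqP; apply: (@derivn_eq0 r) => k.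
  rewrite Hq /polyop horner_sum big1// => j _; rewrite hornerZ.
  suff -> : iter j delta (diffop m d f - polyop Q delta f) =
      diffop m d (iter j delta f) - polyop Q delta (iter j delta f).
    by rewrite hornerD hornerN val subrr mulr0.
  elim: (nat_of_ord j) => //= i ->.
  by rewrite comm /delta linearB /= polyop_commute.
have td := triangular_polyop Q (triangular_second_order 0 srho sf1).
have := triangular_coef n td; rewrite /= addr0 => <-.
by rewrite -(triangular_coef n tE) eqE.
Qed.

End Root.
End EigenvaluePolynomials.

(** * Matrix-valued orthogonal polynomials *)

Section GramSystem.
Variables (F : fieldType) (U : Type) (m : nat) (B : U -> U -> F) (e : 'I_m -> U).
Variable comb : 'rV[F]_m -> U.

(** A square Gram matrix with trivial left kernel is invertible. [U] is a bare type, so that rows of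
    bounded degree can be used without making a vector space of them. *)
Lemma gram_solve (phi : U -> F) :
  (forall c u, B (comb c) u = \sum_p c 0 p * B (e p) u) ->
  (forall c, (forall q, B (comb c) (e q) = 0) -> c = 0) ->
  exists c, forall q, B (comb c) (e q) = phi (e q).
Proof.
move=> Bl nd; pose G : 'M[F]_m := \matrix_(p, q) B (e p) (e q).
have BG c q : B (comb c) (e q) = (c *m G) 0 q.
  by rewrite Bl mxE; apply: eq_bigr => p _; rewrite mxE.
have Gu : G \in unitmx.
  rewrite -row_free_unit -kermx_eq0; apply/eqP/row_matrixP => i; rewrite row0.
  apply: nd => q; rewrite BG -row_mul mulmx_ker; by rewrite row0 mxE.
by exists ((\row_q phi (e q)) *m invmx G) => q; rewrite BG mulmxKV// mxE.
Qed.

End GramSystem.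

Section MatrixWeight.
Variables (F : numFieldType) (N : nat) (A : 'M[F]_N).
Variable L : 'I_N -> {scalar {poly F}}.
Hypothesis A_parity : forall i j, A i j != 0 -> ~~ odd i && odd j.

Notation PC := (map_mx polyC).
Notation rowp := 'rV[{poly F}]_N.
Local Notation e := (delta_mx 0 : 'I_N -> rowp).

Definition Tmx : 'M[{poly F}]_N := 1%:M + 'X *: PC A.
Definition Tinvmx : 'M[{poly F}]_N := 1%:M - 'X *: PC A.

(** The middle index would be odd as a column and even as a row. *)
Lemma A_nilpotent i j k : A i j * A j k = 0.
Proof.
apply/eqP; rewrite mulf_eq0; case: eqVneq => //= /A_parity /andP[_ oj].
by apply: contraT => /A_parity; rewrite oj.
Qed.

Lemma A_sqr0 : A *m A = 0.
Proof. by apply/matrixP => i k; rewrite !mxE big1// => j _; apply: A_nilpotent. Qed.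

Lemma Tmx_inv : Tmx *m Tinvmx = 1%:M.
Proof.
rewrite mulmxBr mulmx1 mulmxDl mul1mx -scalemxAl -scalemxAr -map_mxM A_sqr0.
by rewrite map_mx0 !scaler0 addr0 addrK.
Qed.

Lemma Tinvmx_Tmx : Tinvmx *m Tmx = 1%:M.
Proof. exact: mulmx1C Tmx_inv. Qed.

Lemma invmx_Tmx : invmx Tmx = Tinvmx.
Proof.
have [uT _] := mulmx1_unit Tmx_inv.
by rewrite -[LHS]mulmx1 -Tmx_inv mulmxA mulVmx// mul1mx.
Qed.

Lemma Tmx_diag j : Tmx j j = 1.
Proof.
rewrite !mxE eqxx; suff -> : A j j = 0 by rewrite polyC0 mulr0 addr0.
by apply/eqP; apply: contraT => /A_parity; case: odd.
Qed.

Lemma Tinvmx_diag j : Tinvmx j j = 1.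
Proof.
rewrite !mxE eqxx; suff -> : A j j = 0 by rewrite polyC0 mulr0 subr0.
by apply/eqP; apply: contraT => /A_parity; case: odd.
Qed.

Lemma Tmx_offdiag i j : i != j -> Tmx i j = 'X * (A i j)%:P.
Proof. by move=> /negbTE ij; rewrite !mxE ij add0r. Qed.

Lemma Tinvmx_offdiag i j : i != j -> Tinvmx i j = - ('X * (A i j)%:P).
Proof. by move=> /negbTE ij; rewrite !mxE ij add0r. Qed.

Definition row_size_leq n (v : rowp) := forall j, (size (v 0%R j) <= n)%N.

(** This is [int f W g^t], written in the coordinates [f T] where it is diagonal. It is bilinear,
    without conjugation, over the complex numbers too. *)
Definition form (f g : rowp) := \sum_l L l ((f *m Tmx) 0 l * (g *m Tmx) 0 l).

Lemma formC f g : form f g = form g f.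
Proof. by apply: eq_bigr => l _; rewrite mulrC. Qed.

Lemma formDl f g h : form (f + g) h = form f h + form g h.
Proof. by rewrite -big_split; apply: eq_bigr => l _; rewrite mulmxDl mxE mulrDl linearD. Qed.

Lemma formDr f g h : form h (f + g) = form h f + form h g.
Proof. by rewrite !(formC h) formDl. Qed.

Lemma formZl c f h : form (c%:P *: f) h = c * form f h.
Proof.
rewrite mulr_sumr; apply: eq_bigr => l _; rewrite -scalemxAl mxE -mulrA mul_polyC.
by rewrite linearZ.
Qed.

Lemma formZr c f h : form h (c%:P *: f) = c * form h f.
Proof. by rewrite !(formC h) formZl. Qed.

Lemma form0l h : form 0 h = 0.
Proof. by rewrite -(scale0r 0) -polyC0 formZl mul0r. Qed.

Lemma formBr f g h : form h (f - g) = form h f - form h g.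
Proof.
have -> : f - g = f + (-1)%:P *: g by rewrite polyCN scaleN1r.
by rewrite formDr formZr mulN1r.
Qed.

Lemma form_suml (I : finType) (f : I -> rowp) h :
  form (\sum_i f i) h = \sum_i form (f i) h.
Proof.
by apply: (big_morph (fun f => form f h)); [move=> f1 f2; exact: formDl | exact: form0l].
Qed.

Lemma form_sumr (I : finType) (f : I -> rowp) h :
  form h (\sum_i f i) = \sum_i form h (f i).
Proof. by rewrite formC form_suml; apply: eq_bigr => i _; rewrite formC. Qed.

Lemma form_mulPC m (c : 'rV[F]_m) (M : 'M[{poly F}]_(m, N)) h :
  form (PC c *m M) h = \sum_i c 0 i * form (row i M) h.
Proof.
rewrite mulmx_sum_row form_suml; apply: eq_bigr => i _.
by rewrite mxE formZl.
Qed.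

Lemma form_conjr f g : form (f *m Tinvmx) g = \sum_l L l (f 0 l * (g *m Tmx) 0 l).
Proof. by rewrite /form -!mulmxA Tinvmx_Tmx !mulmx1. Qed.

Lemma sum_delta (I : finType) (V : nmodType) (i : I) (G : I -> V) :
  (forall l, l != i -> G l = 0) -> \sum_l G l = G i.
Proof. by move=> G0; rewrite (bigD1 i)//= big1 ?addr0. Qed.

Hypothesis ndform : forall n v, row_size_leq n v ->
  (forall g, row_size_leq n g -> form v g = 0) -> v = 0.

Lemma ndform_eq0 v : (forall g, form v g = 0) -> v = 0.
Proof.
move=> v0; apply: (@ndform (\max_j size (v 0%R j))%N) => // j.
exact: (leq_bigmax (F := fun j => size (v 0%R j))).
Qed.

(** By [ndform] the Gram matrix of the monomial rows [X^k e_i], [k < n], is invertible; the work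
    lies in identifying rows of bounded degree with their coefficient vectors. *)
Lemma riesz n (phi : rowp -> F) :
  (forall f g, phi (f + g) = phi f + phi g) ->
  (forall c f, phi (c%:P *: f) = c * phi f) ->
  exists2 v, row_size_leq n v & forall g, row_size_leq n g -> form v g = phi g.
Proof.
move=> phiD phiZ.
pose J : finType := ('I_N * 'I_n)%type.
pose ee (p : 'I_#|J|) : rowp := 'X^((enum_val p).2) *: e (enum_val p).1.
pose comb (c : 'rV[F]_#|J|) := \sum_p (c 0 p)%:P *: ee p.
have combE c l : comb c 0 l = \sum_(k < n) c 0 (enum_rank (l, k)) *: 'X^k.
  rewrite summxE (reindex (@enum_rank J)) /=; last exact: onW_bij (enum_rank_bij _).
  transitivity (\sum_(a < N) \sum_(b < n)
      ((c 0 (enum_rank (a, b)))%:P *: ee (enum_rank (a, b))) 0 l).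
    by rewrite pair_bigA; apply: eq_bigr => -[].
  rewrite (bigD1 l)//= [X in _ + X]big1 ?addr0.
    by apply: eq_bigr => k _; rewrite !mxE enum_rankK /= !eqxx mulr1 mul_polyC.
  move=> i il; rewrite big1// => k _; rewrite !mxE enum_rankK /=.
  by rewrite eq_sym (negbTE il) !mulr0.
have comb_size c : row_size_leq n (comb c).
  move=> l; rewrite combE; apply: leq_trans (size_sum _ _ _) _; apply/bigmax_leqP => k _.
  by apply: leq_trans (size_scale_leq _ _) _; rewrite size_polyXn.
have comb_surj g : row_size_leq n g -> exists c, g = comb c.
  move=> sg; exists (\row_(p < #|J|) (g 0 (enum_val p).1)`_((enum_val p).2)).
  apply/rowP => l; rewrite combE; apply/polyP => k; rewrite coef_sum.
  have [kn|nk] := ltnP k n.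
    rewrite (bigD1 (Ordinal kn))//= big1 => [|i ik].
      by rewrite mxE enum_rankK coefZ coefXn eqxx mulr1 addr0.
    by rewrite coefZ coefXn eq_sym (negbTE (ik : i != k :> nat)) mulr0.
  rewrite nth_default ?(leq_trans (sg l))// big1// => i _.
  by rewrite coefZ coefXn gtn_eqF ?mulr0// (leq_trans (ltn_ord i)).
have comb_inj c : comb c = 0 -> c = 0.
  move=> c0; apply/rowP => p; have := congr1 (fun v : rowp => (v 0 (enum_val p).1)`_((enum_val p).2)) c0.
  rewrite mxE coef0 combE coef_sum (bigD1 (enum_val p).2)//= big1 => [|i ik].
    by rewrite coefZ coefXn eqxx mulr1 addr0 mxE -surjective_pairing enum_valK.
  by rewrite coefZ coefXn eq_sym (negbTE (ik : i != _ :> nat)) mulr0.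
have form_comb c u : form (comb c) u = \sum_p c 0 p * form (ee p) u.
  by rewrite form_suml; apply: eq_bigr => p _; rewrite formZl.
have nd c : (forall q, form (comb c) (ee q) = 0) -> c = 0.
  move=> c0; apply/comb_inj/(ndform (comb_size c)) => g' /comb_surj[d' ->].
  by rewrite form_sumr big1// => q _; rewrite formZr c0 mulr0.
have [c Hc] := gram_solve phi form_comb nd.
exists (comb c) => // g /comb_surj[d ->].
have -> : phi (comb d) = \sum_p phi ((d 0 p)%:P *: ee p).
  by apply: (big_morph phi phiD); rewrite -(scale0r 0) -polyC0 phiZ mul0r.
by rewrite form_sumr; apply: eq_bigr => p _; rewrite formZr phiZ Hc.
Qed.

Definition monic_orthogonal (P : nat -> 'M[{poly F}]_N) :=
  forall n, (forall i j, (size (P n i j - (i == j)%:R *: 'X^n)%R <= n)%N) /\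
    (forall i g, row_size_leq n g -> form (row i (P n)) g = 0).

(** Row [i] of [P n] is [X^n e_i] minus its projection onto lower degrees. Without such a sequence
    [in_DW], which quantifies over all of them, would be vacuous. *)
Lemma monic_orthogonal_exists : exists P, monic_orthogonal P.
Proof.
have H (x : nat * 'I_N) : exists v, row_size_leq x.1 v /\
    forall g, row_size_leq x.1 g -> form ('X^(x.1) *: e x.2 - v) g = 0.
  have [f g|c f|v sv Hv] := @riesz x.1 (fun g => form ('X^(x.1) *: e x.2) g).
  - exact: formDr.
  - exact: formZr.
  exists v; split=> // g sg; by rewrite formC formBr formC [X in _ - X]formC Hv// subrr.
have [v Hv] := choice H.
exists (fun n => \matrix_(i, j) ('X^n *: e i - v (n, i)) 0 j) => n; split=> [i j|i g sg].
  rewrite !mxE eqxx /= eq_sym mulrC mulr_natl scaler_nat addrAC subrr add0r size_polyN.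
  by case: (Hv (n, i)) => + _; apply.
rewrite (_ : row i _ = 'X^n *: e i - v (n, i)); last by apply/rowP => j; rewrite !mxE.
by case: (Hv (n, i)) => _; apply.
Qed.

Section Orthogonal.
Variable P : nat -> 'M[{poly F}]_N.
Hypothesis moP : monic_orthogonal P.

Lemma mo_orth n c g : row_size_leq n g -> form (PC c *m P n) g = 0.
Proof.
by move=> sg; rewrite form_mulPC big1// => i _; rewrite (moP n).2 ?mulr0.
Qed.

(** As [P n] is monic, [c] is the row of the coefficients of degree [n] of [f]. *)
Lemma mo_expand n f : row_size_leq n.+1 f ->
  exists c, row_size_leq n (f - PC c *m P n).
Proof.
move=> sf; exists (\row_j (f 0 j)`_n) => j.
have -> : (f - PC (\row_j (f 0 j)`_n) *m P n) 0 j =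
  (f 0 j - (f 0 j)`_n *: 'X^n) - \sum_i (f 0 i)`_n *: (P n i j - (i == j)%:R *: 'X^n).
  rewrite !mxE; under [X in _ - X = _]eq_bigr do rewrite !mxE mul_polyC.
  under [X in _ = _ - X]eq_bigr do rewrite scalerBr.
  rewrite sumrB [X in _ = _ - (_ - X)](bigD1 j)//= [X in _ = _ - (_ - (_ + X))]big1.
    by rewrite addr0 eqxx scale1r opprB addrA subrK.
  by move=> i /negbTE ->; rewrite scale0r scaler0.
apply: leq_trans (size_polyD _ _) _; rewrite size_polyN geq_max; apply/andP; split.
  apply/leq_sizeP => k; rewrite leq_eqVlt coefB coefZ coefXn => /orP[/eqP <-|nk].
    by rewrite eqxx mulr1 subrr.
  by rewrite gtn_eqF// mulr0 subr0; apply/(leq_sizeP _ _ (sf j)).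
apply: leq_trans (size_sum _ _ _) _; apply/bigmax_leqP => i _.
by apply: leq_trans (size_scale_leq _ _) _; apply: (moP n).1.
Qed.

Lemma mo_size n c : row_size_leq n.+1 (PC c *m P n).
Proof.
move=> j; rewrite mxE; apply: leq_trans (size_sum _ _ _) _; apply/bigmax_leqP => i _.
rewrite mxE mul_polyC; apply: leq_trans (size_scale_leq _ _) _.
rewrite -(subrK ((i == j)%:R *: 'X^n) (P n i j)); apply: leq_trans (size_polyD _ _) _.
rewrite geq_max (leq_trans ((moP n).1 i j))//.
by apply: leq_trans (size_scale_leq _ _) _; rewrite size_polyXn.
Qed.

Lemma row_size_leqD n f g : row_size_leq n f -> row_size_leq n g -> row_size_leq n (f + g).
Proof.
by move=> sf sg j; rewrite mxE (leq_trans (size_polyD _ _))// geq_max sf sg.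
Qed.

(** Repeating [mo_expand] writes every row as a combination of the [P n] with constant coefficients,
    which gives this induction on degree bounds. *)
Lemma mo_ind (Q : nat -> rowp -> Prop) :
  Q 0%N 0 -> (forall n c f, row_size_leq n f -> Q n f -> Q n.+1 (PC c *m P n + f)) ->
  forall n f, row_size_leq n f -> Q n f.
Proof.
move=> Q0 QS; elim=> [|n IH] f sf.
  suff -> : f = 0 by [].
  by apply/rowP => j; apply/eqP; have := sf j; rewrite leqn0 size_poly_eq0 !mxE.
have [c sc] := mo_expand sf; rewrite -(subrK (PC c *m P n) f) addrC.
by apply: QS => //; apply: IH.
Qed.

End Orthogonal.
End MatrixWeight.

(** * Operators with the orthogonal polynomials as eigenfunctions *)

Section Eigenoperator.
Variables (F : numFieldType) (N : nat) (A : 'M[F]_N).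
Variable L : 'I_N -> {scalar {poly F}}.
Hypothesis A_parity : forall i j, A i j != 0 -> ~~ odd i && odd j.
Hypothesis ndL : forall l, nondegenerate (L l).
Hypothesis ndform : forall n v, row_size_leq n v ->
  (forall g, row_size_leq n g -> form A L v g = 0) -> v = 0.

Notation PC := (map_mx polyC).
Notation rowp := 'rV[{poly F}]_N.
Local Notation e := (delta_mx 0 : 'I_N -> rowp).
Local Notation T := (Tmx A).
Local Notation Tinv := (Tinvmx A).
Local Notation form := (form A L).

(* Convertible to [dact] when [n = N]. *)
Definition dactm n (f : 'M[{poly F}]_(n, N)) (D : seq 'M[{poly F}]_N) :=
  \sum_(j < size D) map_mx (fun p => p^`(j)) f *m D`_j.

Lemma dactmD n (f g : 'M[{poly F}]_(n, N)) D : dactm (f + g) D = dactm f D + dactm g D.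
Proof.
rewrite -big_split; apply: eq_bigr => k _ /=; rewrite -mulmxDl; congr (_ *m _).
by apply/matrixP => i j; rewrite !mxE linearD.
Qed.

Lemma dactm_mulPC m n (c : 'M[F]_(m, n)) (f : 'M[{poly F}]_(n, N)) D :
  dactm (PC c *m f) D = PC c *m dactm f D.
Proof.
rewrite mulmx_sumr; apply: eq_bigr => k _; rewrite mulmxA; congr (_ *m _).
apply/matrixP => i j; rewrite !mxE linear_sum; apply: eq_bigr => l _.
by rewrite !mxE !mul_polyC linearZ.
Qed.

Lemma dactm_row n (f : 'M[{poly F}]_(n, N)) D i : row i (dactm f D) = dactm (row i f) D.
Proof.
rewrite linear_sum; apply: eq_bigr => k _; rewrite /= row_mul; congr (_ *m _).
by apply/rowP => j; rewrite !mxE.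
Qed.

Lemma dactm0 n D : dactm (0 : 'M[{poly F}]_(n, N)) D = 0.
Proof.
have := dactmD (0 : 'M[{poly F}]_(n, N)) 0 D; rewrite addr0 => /eqP.
by rewrite -subr_eq0 opprD addrA subrr sub0r oppr_eq0 => /eqP.
Qed.

Lemma dactm_sum n (I : finType) (f : I -> 'M[{poly F}]_(n, N)) D :
  dactm (\sum_i f i) D = \sum_i dactm (f i) D.
Proof.
by apply: (big_morph (fun f => dactm f D)); [move=> ? ?; exact: dactmD | exact: dactm0].
Qed.

Lemma A_offdiag i j : A i j != 0 -> i != j.
Proof. by move=> /A_parity/andP[io jo]; apply: contraNneq io => ->. Qed.

Lemma row_Tinv_expand (f : rowp) : f = \sum_k (f *m T) 0 k *: e k *m Tinv.
Proof.
rewrite -mulmx_suml.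
have -> : \sum_k (f *m T) 0 k *: e k = f *m T by rewrite [RHS]row_sum_delta.
by rewrite -mulmxA Tmx_inv// mulmx1.
Qed.

Lemma scale_eT (f : {poly F}) i k : (f *: e i *m T) 0 k = f * T i k.
Proof. by rewrite -scalemxAl -rowE mxE mxE. Qed.

Lemma scale_eTinv (f : {poly F}) i k : (f *: e i *m Tinv) 0 k = f * Tinv i k.
Proof. by rewrite -scalemxAl -rowE mxE mxE. Qed.

(* The two sums are the entries of [T G T^-1] for a diagonal operator [G]. *)
Lemma conj_diag_entry (G : 'I_N -> {poly F} -> {poly F}) (f : {poly F}) j :
  (forall k, G k 0 = 0) -> \sum_k G k (f * T j k) * Tinv k j = G j f.
Proof.
move=> G0; rewrite (sum_delta (i := j)) => [|k kj].
  by rewrite Tmx_diag// Tinvmx_diag// !mulr1.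
rewrite Tmx_offdiag 1?eq_sym// Tinvmx_offdiag//.
have [->|/(@A_parity _ _)/andP[jo ke]] := eqVneq (A j k) 0.
  by rewrite polyC0 !mulr0 G0 mul0r.
have [->|/(@A_parity _ _)/andP[/negP]//] := eqVneq (A k j) 0.
by rewrite polyC0 mulr0 oppr0 mulr0.
Qed.

(** Only [k = i] and [k = j] contribute: any other intermediate index would be both an odd column
    and an even row of [A]. *)
Lemma conj_offdiag_entry (G : 'I_N -> {poly F} -> {poly F}) (f : {poly F}) i j :
  (forall k, G k 0 = 0) -> i != j ->
  \sum_k G k (f * T i k) * Tinv k j =
  G j (f * ('X * (A i j)%:P)) - G i f * ('X * (A i j)%:P).
Proof.
move=> G0 ij.
rewrite (bigD1 i)//= (bigD1 j) 1?eq_sym//= big1 => [|k /andP[ki kj]].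
  rewrite Tmx_diag// Tinvmx_diag// Tinvmx_offdiag// Tmx_offdiag// !mulr1 addr0 mulrN.
  exact: addrC.
rewrite Tmx_offdiag 1?eq_sym// Tinvmx_offdiag//.
have [->|/(@A_parity _ _)/andP[_ ko]] := eqVneq (A i k) 0.
  by rewrite polyC0 !mulr0 G0 mul0r.
have [->|/(@A_parity _ _)/andP[/negP]//] := eqVneq (A k j) 0.
by rewrite polyC0 mulr0 oppr0 mulr0.
Qed.

Variables (D : seq 'M[{poly F}]_N) (P : nat -> 'M[{poly F}]_N).
Hypothesis moP : monic_orthogonal A L P.
Hypothesis eigP : forall n, exists Lam, dactm (P n) D = PC Lam *m P n.

Lemma dactm_mo n (c : 'rV[F]_N) : exists c', dactm (PC c *m P n) D = PC c' *m P n.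
Proof.
have [Lam e] := eigP n; exists (c *m Lam).
by rewrite dactm_mulPC e mulmxA -map_mxM.
Qed.

Lemma dactm_size n (f : rowp) : row_size_leq n f -> row_size_leq n (dactm f D).
Proof.
apply: (mo_ind moP (Q := fun n f => row_size_leq n (dactm f D))) => [|{}n c {}f _ sf].
  by rewrite dactm0 => j; rewrite mxE size_poly0.
rewrite dactmD; have [c' ->] := dactm_mo n c; apply: row_size_leqD.
  exact: (mo_size moP).
by move=> j; apply: leqW; apply: sf.
Qed.

(** [riesz] gives [v] with the identity for [f] of size at most [n]. Along [P m] with [m >= n] both
    sides vanish: [D] only multiplies [P m] by a constant matrix on the left, and [g] and [v] have
    size at most [m]. Hence the adjoint does not raise degrees either. *)
Lemma dactm_adjoint n g : row_size_leq n g ->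
  exists2 v, row_size_leq n v & forall f, form (dactm f D) g = form f v.
Proof.
move=> sg.
have [f h|c f|v sv Hv] := riesz ndform n (phi := fun f => form (dactm f D) g).
- by rewrite dactmD formDl.
- have -> : c%:P *: f = PC (c%:M : 'M[F]_1) *m f.
    by rewrite map_scalar_mx mul_scalar_mx.
  by rewrite dactm_mulPC map_scalar_mx mul_scalar_mx formZl.
exists v => // f.
have [m sf] : exists m, row_size_leq m f.
  exists (\max_j size (f 0%R j))%N => j.
  exact: (leq_bigmax (F := fun j => size (f 0%R j)) j).
move: m f sf; apply: (mo_ind moP (Q := fun m f => form (dactm f D) g = form f v)) => [|m c f sf IH].
  by rewrite dactm0 !form0l.
have [mn|nm] := ltnP m n.
  rewrite -Hv; first by rewrite formC.
  apply: row_size_leqD => j; apply: leq_trans mn; first exact: (mo_size moP).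
  by apply: leqW; apply: sf.
have [c' ec] := dactm_mo m c; rewrite dactmD !formDl IH ec.
by rewrite !(mo_orth moP)// => j; rewrite (leq_trans _ nm).
Qed.

Lemma star_exists : exists star : rowp -> rowp, forall g,
  (forall f, form (dactm f D) g = form f (star g)) /\
  (forall n, row_size_leq n g -> row_size_leq n (star g)).
Proof.
have H (g : rowp) : exists v, (forall f, form (dactm f D) g = form f v) /\
    (forall n, row_size_leq n g -> row_size_leq n v).
  have [|v sv Hv] := @dactm_adjoint (\max_j size (g 0%R j))%N g.
    by move=> j; apply: (leq_bigmax (F := fun j => size (g 0%R j)) j).
  exists v; split=> // n sg j; apply: leq_trans (sv j) _.
  by apply/bigmax_leqP => i _; apply: sg.
by have [star Hs] := choice H; exists star.
Qed.

Variables (rho : {poly F}) (f1 : 'I_N -> {poly F}).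
Hypothesis rho_neq0 : rho != 0.
Hypothesis pL : forall l, pearson (L l) rho (f1 l).
Hypothesis ratioL : forall i j, i != j -> forall u v, u != 0 -> v != 0 ->
  ratio_poly rho (f1 i) (f1 j) u v != 0.

Section Star.
Variable star : rowp -> rowp.
Hypothesis starE : forall g f, form (dactm f D) g = form f (star g).
Hypothesis star_size : forall g n, row_size_leq n g -> row_size_leq n (star g).

(** Entry [(i, j)] of [E = T^-1 D T] in the right action: a row is multiplied by [T^-1], acted upon
    by [D], then multiplied by [T]. *)
Definition conj_entry i j (f : {poly F}) : {poly F} := (dactm (f *: e i *m Tinv) D *m T) 0 j.
Definition star_entry j i (g : {poly F}) : {poly F} := (star (g *: e j *m Tinv) *m T) 0 i.

(** In the coordinates [f T] the form is the orthogonal sum of the [L l], so adjointness holds entry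
    by entry. *)
Lemma conj_entry_adjoint i j f g :
  L j (conj_entry i j f * g) = L i (f * star_entry j i g).
Proof.
have := starE (g *: e j *m Tinv) (f *: e i *m Tinv).
rewrite formC !form_conjr// (sum_delta (i := j)); last first.
  by move=> l lj; rewrite !mxE eqxx (negbTE lj) mulr0 mul0r linear0.
rewrite (sum_delta (i := i)); last first.
  by move=> l lj; rewrite !mxE eqxx (negbTE lj) mulr0 mul0r linear0.
have -> (x : {poly F}) k : (x *: e k) 0 k = x by rewrite !mxE !eqxx mulr1.
by rewrite mulrC => ->; congr (L i (_ * _)); rewrite !mxE !eqxx mulr1.
Qed.

(** All orders of differentiation in [D] are below [size D], so the factor [rho ^+ size D] pays for
    every integration by parts. *)
Lemma conj_entry_represented i j g :
  exists u, forall f, L j (conj_entry i j (rho ^+ size D * f) * g) = L j (f * u).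
Proof.
have H (x : 'I_(size D) * 'I_N) : exists u, forall f,
    L j ((rho ^+ size D * f * Tinv i x.2)^`(x.1) * \sum_c D`_(x.1) x.2 c * T c j * g) = L j (f * u).
  have [u Hu] := derivn_represented (\sum_c D`_(x.1) x.2 c * T c j * g) (pL j) (ltnW (ltn_ord x.1)).
  by exists (Tinv i x.2 * u) => f; rewrite -mulrA Hu mulrA.
have [u Hu] := sum_represented H; exists u => f; rewrite -Hu -linear_sum; congr (L j _).
rewrite /conj_entry mxE mulr_suml.
under eq_bigr => c _.
  rewrite summxE mulr_suml mulr_suml.
  under eq_bigr => k _.
    rewrite mxE mulr_suml mulr_suml.
    under eq_bigr => a _ do rewrite mxE scale_eTinv.
  over.
over.
transitivity (\sum_(k < size D) \sum_(a < N)
    (rho ^+ size D * f * Tinv i a)^`(k) * \sum_c D`_k a c * T c j * g); last first.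
  by rewrite pair_bigA.
rewrite exchange_big; apply: eq_bigr => k _; rewrite exchange_big; apply: eq_bigr => a _.
by rewrite mulr_sumr; apply: eq_bigr => c _; rewrite !mulrA.
Qed.

(** Let [s = size D]. For fixed [g], pairing [E_ij (rho^s h)] with [g] under [L j] gives [L j (u h)]
    by integration by parts and [L i] of [rho^s h] times a star entry by adjointness. By
    [proportional_functionals] this relation is trivial, so the star entry is zero, and then so is
    [E_ij]. *)
Lemma offdiag_eq0 i j : i != j ->
  (forall f, conj_entry i j f = 0) /\ (forall g, star_entry j i g = 0).
Proof.
move=> ij.
have S0 g : star_entry j i g = 0.
  have [u Hu] := conj_entry_represented i j g.
  have [] := @proportional_functionals F (L j) (L i) rho (f1 j) (f1 i) u
     (rho ^+ size D * star_entry j i g) => //.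
  - by apply: ratioL; rewrite eq_sym.
  - move=> h; rewrite mulrC -Hu conj_entry_adjoint; congr (L i _); ring.
  by move=> _ /eqP; rewrite mulf_eq0 expf_eq0 (negbTE rho_neq0) andbF => /eqP.
split=> // f; apply: (nondegenerate_eq0 (@ndL j)) => g.
by rewrite conj_entry_adjoint S0 mulr0 linear0.
Qed.

Definition diag_op l (f : {poly F}) := conj_entry l l f.
Definition diag_star l (g : {poly F}) := star_entry l l g.

Lemma row_diag (v : rowp) k x : (v *m T) 0 k = x ->
  (forall l, l != k -> (v *m T) 0 l = 0) -> v = x *: e k *m Tinv.
Proof.
move=> vk vl; rewrite -[v]mulmx1 -(Tmx_inv A_parity) mulmxA; congr (_ *m _).
apply/rowP => l; rewrite [RHS]mxE [e k 0 l]mxE eqxx /=.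
by have [->|/vl ->] := eqVneq l k; rewrite ?mulr1// mulr0.
Qed.

Lemma dactm_diag f : dactm f D = \sum_k diag_op k ((f *m T) 0 k) *: e k *m Tinv.
Proof.
rewrite {1}(row_Tinv_expand f) dactm_sum; apply: eq_bigr => k _.
by apply: row_diag => // l lk; apply: (offdiag_eq0 _).1; rewrite eq_sym.
Qed.

Lemma star_diag f : star f = \sum_k diag_star k ((f *m T) 0 k) *: e k *m Tinv.
Proof.
apply/eqP; rewrite -subr_eq0; apply/eqP; apply: (ndform_eq0 ndform) => h.
rewrite formC formBr -starE {1}(row_Tinv_expand f) !form_sumr -sumrB big1// => k _.
rewrite starE [star _](@row_diag _ k (diag_star k ((f *m T) 0 k))) ?subrr// => l lk.
exact: (offdiag_eq0 _).2.
Qed.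

Lemma diag_op0 k : diag_op k 0 = 0.
Proof. by rewrite /diag_op /conj_entry scale0r mul0mx dactm0 mul0mx mxE. Qed.

Lemma diag_star0 k : diag_star k 0 = 0.
Proof.
rewrite /diag_star /star_entry scale0r mul0mx.
suff -> : star 0 = 0 by rewrite mul0mx mxE.
by apply: (ndform_eq0 ndform) => h; rewrite formC -starE formC form0l.
Qed.

Lemma dactm_entry f i j :
  (dactm (f *: e i) D) 0 j = \sum_k diag_op k (f * T i k) * Tinv k j.
Proof.
by rewrite dactm_diag summxE; apply: eq_bigr => k _; rewrite scale_eTinv scale_eT.
Qed.

Lemma star_entryE f i j :
  (star (f *: e i)) 0 j = \sum_k diag_star k (f * T i k) * Tinv k j.
Proof.
by rewrite star_diag summxE; apply: eq_bigr => k _; rewrite scale_eTinv scale_eT.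
Qed.

Lemma size_scale_e n (f : {poly F}) i : (size f <= n)%N -> row_size_leq n (f *: e i).
Proof.
by move=> sf j; rewrite !mxE eqxx /=; case: (j == i); rewrite ?mulr1// mulr0 size_poly0.
Qed.

(** Conjugation by [T] does not change the diagonal entries ([conj_diag_entry]), so the coefficients
    of [E_l] can be read off the diagonals of those of [D]. *)
Lemma diag_op_diffop l f : diag_op l f = diffop (size D) (fun k => D`_k l l) f.
Proof.
rewrite -(conj_diag_entry f l diag_op0) -dactm_entry summxE.
apply: eq_bigr => k _; rewrite mxE (sum_delta (i := l)).
  by rewrite !mxE !eqxx mulr1.
by move=> a al; rewrite !mxE (negbTE al) andbF mulr0 linear0 mul0r.
Qed.

Lemma diag_star_size l n (f : {poly F}) : (size f <= n)%N -> (size (diag_star l f) <= n)%N.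
Proof.
move=> sf; rewrite -(conj_diag_entry f l diag_star0) -star_entryE.
by apply: star_size; apply: size_scale_e.
Qed.

Lemma diag_op_size l (f : {poly F}) : (size (diag_op l f) <= size f)%N.
Proof.
rewrite -(conj_diag_entry f l diag_op0) -dactm_entry.
by apply: dactm_size; apply: size_scale_e.
Qed.

Definition eigenvalue_poly l := \sum_(k < size D) (D`_k l l)`_k *: falling F k.

Lemma diag_op_triangular l : triangular (diag_op l) (fun n => (eigenvalue_poly l).[n%:R]).
Proof.
move=> n f sf; have := @linear_triangular _ (diffop (size D) (fun k => D`_k l l)) _ n f sf.
rewrite diffop_eigenvalue diag_op_diffop; apply=> g.
by have := diag_op_size l g; rewrite diag_op_diffop.
Qed.

Lemma diag_op_adjoint l : adjoint_pair (L l) (diag_op l) (diag_star l).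
Proof. by move=> f g; apply: conj_entry_adjoint. Qed.

(** Entry [j] of the image of [X^n e_i] is [A i j] times [E_j X^(n+1) - X E_i X^n]. As [D] does not
    raise degrees, its coefficient of degree [n+1] is zero. *)
Lemma eigenvalue_shift i j n : A i j != 0 ->
  (eigenvalue_poly j).[n.+1%:R] = (eigenvalue_poly i).[n%:R].
Proof.
move=> Aij; have ij := A_offdiag Aij.
rewrite -(triangular_coef n.+1 (diag_op_triangular j)) -(triangular_coef n (diag_op_triangular i)).
have := dactm_size (@size_scale_e n.+1 'X^n i _); rewrite size_polyXn => /(_ (leqnn _) j).
rewrite dactm_entry (conj_offdiag_entry _ diag_op0 ij).
have -> : diag_op j ('X^n * ('X * (A i j)%:P)) = A i j *: diag_op j 'X^(n.+1).
  by rewrite !diag_op_diffop -linearZ; congr (diffop _ _ _); rewrite exprSr -mul_polyC; ring.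
rewrite mulrA mulrC mul_polyC -scalerBr => /leq_sizeP /(_ n.+1 (leqnn _)) /eqP.
by rewrite coefZ mulf_eq0 (negbTE Aij) coefB coefMX /= subr_eq0 => /eqP.
Qed.

End Star.
End Eigenoperator.

(** * Polynomials in the conjugated classical operator *)

Section Classification.
Variables (F : numFieldType) (N : nat) (A : 'M[F]_N).
Variable L : 'I_N -> {scalar {poly F}}.
Hypothesis A_parity : forall i j, A i j != 0 -> ~~ odd i && odd j.
Hypothesis ndL : forall l, nondegenerate (L l).
Hypothesis ndform : forall n v, row_size_leq n v ->
  (forall g, row_size_leq n g -> form A L v g = 0) -> v = 0.
Variables (rho : {poly F}) (f1 : 'I_N -> {poly F}) (kappa : 'I_N -> F).
Hypotheses (srho : (size rho <= 3)%N) (sf1 : forall l, (size (f1 l) <= 2)%N).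
Hypothesis pL : forall l, pearson (L l) rho (f1 l).
Hypothesis f1_shift : forall i j, A i j != 0 -> (f1 i)`_1 = (f1 j)`_1 + rho`_2 *+ 2.
Hypothesis kappa_shift : forall i j, A i j != 0 -> kappa i = kappa j + (f1 j)`_1.

Notation PC := (map_mx polyC).
Notation rowp := 'rV[{poly F}]_N.
Local Notation e := (delta_mx 0 : 'I_N -> rowp).
Local Notation T := (Tmx A).
Local Notation Tinv := (Tinvmx A).
Local Notation form := (form A L).

Definition scalar_op l := second_order rho (f1 l) (kappa l).
HB.instance Definition _ l := GRing.Linear.on (scalar_op l).

Definition lam_poly l : {poly F} :=
  rho`_2 *: ('X * ('X - 1)) + (f1 l)`_1 *: 'X + (kappa l)%:P.

Lemma scalar_op_triangular l : triangular (scalar_op l) (fun n => (lam_poly l).[n%:R]).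
Proof.
move=> n f sf; have := triangular_second_order (kappa l) srho (sf1 l) sf.
suff -> : (lam_poly l).[n%:R] = rho`_2 * (n * n.-1)%:R + (f1 l)`_1 * n%:R + kappa l by [].
rewrite !(hornerD, hornerZ, hornerM, hornerX, hornerN, hornerC) natrM.
by case: n {sf} => [|n]; rewrite ?mul0r//= -natr1 addrK.
Qed.

(** Both sides have the same quadratic term; [f1_shift] and [kappa_shift] equate the coefficients of
    [n] and the constant terms. *)
Lemma lam_shift i j n : A i j != 0 -> (lam_poly j).[n.+1%:R] = (lam_poly i).[n%:R].
Proof.
move=> Aij; rewrite !(hornerD, hornerZ, hornerM, hornerX, hornerN, hornerC).
by rewrite (f1_shift Aij) (kappa_shift Aij) -natr1; ring.
Qed.

Definition diag_act n (g : 'M[{poly F}]_(n, N)) := \matrix_(i, k) scalar_op k (g i k).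

(* [T (d^2 rho + d F1 + kappa) T^-1] expanded with [T' = A], [T'' = 0]. *)
Definition conj_diag_op : seq 'M[{poly F}]_N :=
  let F1 := diag_mx (\row_i f1 i) in
  [:: (PC A *m F1 + T *m diag_mx (\row_i (kappa i)%:P)) *m Tinv;
      (2%:P *: (rho *: PC A) + T *m F1) *m Tinv; rho%:M].

Lemma dactm_conj_diag_op n (f : 'M[{poly F}]_(n, N)) :
  dactm f conj_diag_op = diag_act (f *m T) *m Tinv.
Proof.
pose d m (g : 'M[{poly F}]_(m, N)) := map_mx (fun p => p^`()) g.
have dM (g : 'M[{poly F}]_(n, N)) (B : 'M[{poly F}]_N) : d _ (g *m B) = d _ g *m B + g *m d _ B.
  apply/matrixP => i j; rewrite !mxE linear_sum -big_split; apply: eq_bigr => k _.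
  by rewrite /= !mxE derivM.
have dC : d _ (PC A) = 0 by apply/matrixP => i j; rewrite !mxE derivC.
have dT : d _ T = PC A.
  apply/matrixP => i j; rewrite !mxE -polyC_natr derivD derivM derivX !derivC.
  by rewrite mulr0 addr0 mul1r add0r.
have dD (g h : 'M[{poly F}]_(n, N)) : d _ (g + h) = d _ g + d _ h.
  by apply/matrixP => i j; rewrite !mxE derivD.
have d1 : d _ (f *m T) = d _ f *m T + f *m PC A by rewrite dM dT.
have d2 : d _ (d _ (f *m T)) = d _ (d _ f) *m T + d _ f *m PC A + d _ f *m PC A.
  by rewrite d1 dD !dM dT dC mulmx0 addr0.
have actE (g : 'M[{poly F}]_(n, N)) : diag_act g = rho *: d _ (d _ g) +
   d _ g *m diag_mx (\row_i f1 i) + g *m diag_mx (\row_i (kappa i)%:P).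
  apply/matrixP => i k; rewrite !mul_mx_diag !mxE /scalar_op /second_order.
  by rewrite -mul_polyC derivSn derivn1; ring.
rewrite /dactm /= !big_ord_recr big_ord0 /= add0r actE d2 d1.
rewrite map_mx_id//.
have -> : map_mx (fun p : {poly F} => (p^`())^`()) f = d _ (d _ f).
  by apply/matrixP => i j; rewrite !mxE.
rewrite -/(d _ f) mul_mx_scalar -[d _ (d _ f) in LHS]mulmx1 -(Tmx_inv A_parity).
rewrite !(mulmxA _ _ Tinv) scalemxAl -!mulmxDl; congr (_ *m _).
move: (Tmx A) => T'.
rewrite !mulmxDr !mulmxDl !mulmxA !scalerDr -!scalemxAr.
(* The factor [2] is split to match the two copies of [f' A] in the second derivative of [f T]. *)
rewrite (_ : 2%:P = 1 + 1) 1?scalerDl 1?scale1r; last by rewrite -polyC1 -polyCD.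
by rewrite [LHS](AC (2*3*1) (6*3*4*(5*1)*2)).
Qed.

Lemma dactm_conj_diag_row (f : rowp) :
  dactm f conj_diag_op = \sum_k scalar_op k ((f *m T) 0 k) *: e k *m Tinv.
Proof.
rewrite dactm_conj_diag_op -mulmx_suml; congr (_ *m _).
by rewrite [LHS]row_sum_delta; apply: eq_bigr => k _; rewrite mxE.
Qed.

Lemma iter_conj_diag_op m n (f : 'M[{poly F}]_(n, N)) :
  iter m (fun g => dactm g conj_diag_op) f =
  (\matrix_(i, k) iter m (scalar_op k) ((f *m T) i k)) *m Tinv.
Proof.
elim: m => [|m IH] /=.
  rewrite (_ : \matrix_(i, k) _ = f *m T); last by apply/matrixP => i k; rewrite [LHS]mxE.
  by rewrite -mulmxA Tmx_inv// mulmx1.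
rewrite IH dactm_conj_diag_op -mulmxA Tinvmx_Tmx// mulmx1; congr (_ *m _).
by apply/matrixP => i k; rewrite [LHS]mxE [in LHS]mxE [RHS]mxE.
Qed.

Lemma poly_conj_diag_op (q : {poly F}) n (f : 'M[{poly F}]_(n, N)) :
  \sum_(k < size q) (q`_k)%:P *: iter k (fun g => dactm g conj_diag_op) f =
  (\matrix_(i, k) polyop q (scalar_op k) ((f *m T) i k)) *m Tinv.
Proof.
under eq_bigr => m _ do rewrite iter_conj_diag_op scalemxAl.
rewrite -mulmx_suml; congr (_ *m _); apply/matrixP => i k.
by rewrite summxE [RHS]mxE; apply: eq_bigr => m _; rewrite 2!mxE mul_polyC.
Qed.

Lemma conj_diag_op_sym f g : form (dactm f conj_diag_op) g = form f (dactm g conj_diag_op).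
Proof.
rewrite !dactm_conj_diag_op [RHS]formC !form_conjr//.
apply: eq_bigr => l _; have E (v : rowp) : diag_act v 0 l = scalar_op l (v 0 l) by rewrite mxE.
by rewrite !E (second_order_sym _ (@pL l)) mulrC.
Qed.

(** Only off-diagonal entries could raise the degree. By [lam_shift], [scalar_op j] one degree
    higher and [scalar_op i] have the same eigenvalue [l], so their top terms cancel. *)
Lemma conj_diag_op_size n f : row_size_leq n f -> row_size_leq n (dactm f conj_diag_op).
Proof.
move=> sf j; rewrite dactm_conj_diag_row summxE.
under eq_bigr => k _ do rewrite scale_eTinv mxE linear_sum mulr_suml.
rewrite exchange_big; apply: leq_trans (size_sum _ _ _) _; apply/bigmax_leqP => i _ /=.
have G0 k : scalar_op k 0 = 0 by apply: linear0.
have [->|ij] := eqVneq i j.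
  rewrite (conj_diag_entry A_parity _ _ G0).
  exact: triangular_leq (@scalar_op_triangular j) (sf j).
rewrite (conj_offdiag_entry A_parity _ G0 ij).
have [->|Aij] := eqVneq (A i j) 0.
  by rewrite polyC0 !mulr0 G0 subrr size_poly0.
have [->|nz] := eqVneq (f 0 i) 0; first by rewrite mul0r !G0 mul0r subrr size_poly0.
have := sf i; case: n {sf} => [|n] sf.
  by move: sf; rewrite leqn0 size_poly_eq0 (negbTE nz).
have s1 := scalar_op_triangular i sf.
have s2 : (size (f 0 i * ('X * (A i j)%:P))%R <= n.+2)%N.
  rewrite (_ : f 0 i * _ = A i j *: (f 0 i * 'X)); last by rewrite -mul_polyC; ring.
  by apply: leq_trans (size_scale_leq _ _) _; rewrite size_mulX.
have {s2} := scalar_op_triangular j s2; rewrite (lam_shift _ Aij) => s2.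
set l := (lam_poly i).[n%:R] in s1 s2.
have -> : scalar_op j (f 0 i * ('X * (A i j)%:P)) - scalar_op i (f 0 i) * ('X * (A i j)%:P)
  = (scalar_op j (f 0 i * ('X * (A i j)%:P)) - l *: (f 0 i * ('X * (A i j)%:P))) -
    A i j *: ((scalar_op i (f 0 i) - l *: f 0 i) * 'X).
  by rewrite -!mul_polyC; ring.
apply: leq_trans (size_polyD _ _) _; rewrite size_polyN geq_max s2.
apply: leq_trans (size_scale_leq _ _) _; apply: leq_trans (size_polyMleq _ _) _.
by rewrite size_polyX addn2.
Qed.

Section Orthogonal.
Variable P : nat -> 'M[{poly F}]_N.
Hypothesis moP : monic_orthogonal A L P.

(** The image of a row of [P n] is [c P n] plus a row of lower degree. Symmetry of the operator
    makes this remainder orthogonal to all lower degrees, hence zero. *)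
Lemma conj_diag_op_eigen n : exists Lam, dactm (P n) conj_diag_op = PC Lam *m P n.
Proof.
have H i : exists c, dactm (row i (P n)) conj_diag_op = PC c *m P n.
  have sP : row_size_leq n.+1 (row i (P n)).
    by have := @mo_size _ _ _ _ _ moP n (delta_mx 0 i : 'rV[F]_N); rewrite map_delta_mx -rowE.
  have [c sc] := mo_expand moP (conj_diag_op_size sP); exists c.
  apply/eqP; rewrite -subr_eq0; apply/eqP; apply: (ndform sc) => g sg.
  rewrite formC formBr formC conj_diag_op_sym (moP n).2 ?sub0r; last exact: conj_diag_op_size.
  by rewrite formC (mo_orth moP) ?oppr0.
have [c Hc] := choice H; exists (\matrix_i c i).
apply/row_matrixP => i; rewrite dactm_row Hc row_mul; congr (_ *m _).
by apply/rowP => j; rewrite !mxE.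
Qed.

End Orthogonal.

Variables (D : seq 'M[{poly F}]_N) (P : nat -> 'M[{poly F}]_N) (l0 : 'I_N).
Hypothesis moP : monic_orthogonal A L P.
Hypothesis eigP : forall n, exists Lam, dactm (P n) D = PC Lam *m P n.
Hypothesis rho_neq0 : rho != 0.
Hypothesis ratioL : forall i j, i != j -> forall u v, u != 0 -> v != 0 ->
  ratio_poly rho (f1 i) (f1 j) u v != 0.
Hypothesis l0_eq0 : l0 = 0%N :> nat.
Hypothesis A_chain : forall i j : 'I_N, j = i.+1 :> nat -> (A i j != 0) || (A j i != 0).
Hypothesis eigen0 : forall m d V mu, triangular (diffop m d) mu ->
  adjoint_pair (L l0) (diffop m d) V ->
  (forall n (g : {poly F}), (size g <= n)%N -> (size (V g) <= n)%N) ->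
  exists q, forall n, mu n = q.[(lam_poly l0).[n%:R]].

Theorem eigenoperator_polynomial : exists q : {poly F}, forall n (f : 'M[{poly F}]_(n, N)),
  dactm f D = \sum_(k < size q) (q`_k)%:P *: iter k (fun g => dactm g conj_diag_op) f.
Proof.
have [star Hs] := star_exists ndform moP eigP.
have starE g f : form (dactm f D) g = form f (star g) by case: (Hs g).
have sstar g n : row_size_leq n g -> row_size_leq n (star g) by case: (Hs g) => _; apply.
have tD l : triangular (diag_op A D l) (fun n => (eigenvalue_poly D l).[n%:R]).
  exact: (diag_op_triangular A_parity ndL moP eigP rho_neq0 pL ratioL starE).
have aD l : adjoint_pair (L l) (diag_op A D l) (diag_star A star l).
  exact: (diag_op_adjoint A_parity starE).
have sS l n (g : {poly F}) : (size g <= n)%N -> (size (diag_star A star l g) <= n)%N.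
  exact: (diag_star_size A_parity ndL ndform rho_neq0 pL ratioL starE sstar).
have dE l f : diag_op A D l f = diffop (size D) (fun k => D`_k l l) f.
  exact: (diag_op_diffop A_parity ndL rho_neq0 pL ratioL starE).
have shift i j n : A i j != 0 ->
    (eigenvalue_poly D j).[n.+1%:R] = (eigenvalue_poly D i).[n%:R].
  exact: (eigenvalue_shift A_parity ndL moP eigP rho_neq0 pL ratioL starE).
have [q Hq] : exists q, forall n,
    (eigenvalue_poly D l0).[n%:R] = q.[(lam_poly l0).[n%:R]].
  apply: (eigen0 (m := size D) (d := fun k => D`_k l0 l0) (V := diag_star A star l0)) => //.
  - by move=> n f sf; rewrite -dE; apply: tD.
  - by move=> f g; rewrite -dE; apply: aD.
  - exact: sS.
(* The identity propagates from index 0 along the chain, consecutive indices being linked by [A] in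
   one direction or the other. *)
have eigE l : eigenvalue_poly D l = q \Po lam_poly l.
  case: l => l lN; elim: l lN => [|l IH] lN.
    apply: (@poly_eq_nat _ _ _ 0) => n _; rewrite horner_comp.
    by rewrite -(_ : l0 = Ordinal lN) ?Hq//; apply: val_inj.
  have lN' := ltnW lN; pose i := Ordinal lN'; pose j := Ordinal lN.
  have /orP[Aij|Aji] := A_chain (erefl : j = i.+1 :> nat).
    (* In this direction the shift says nothing about degree [0] at [j]; two polynomials that agree
       at all [n >= 1] are nevertheless equal. *)
    apply: (@poly_eq_nat _ _ _ 1) => -[//|n] _; rewrite horner_comp (shift i)//.
    by rewrite (lam_shift _ Aij) (IH lN') horner_comp.
  apply: (@poly_eq_nat _ _ _ 0) => n _; rewrite horner_comp -(shift j i)//.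
  by rewrite -(lam_shift _ Aji) (IH lN') horner_comp.
exists q => n F0; apply/row_matrixP => r; rewrite poly_conj_diag_op row_mul dactm_row.
move: (row_mul r F0 T); set f := row r F0 => eqf.
have -> : row r (\matrix_(i, k) polyop q (scalar_op k) ((F0 *m T) i k)) =
    \sum_k polyop q (scalar_op k) ((f *m T) 0 k) *: e k.
  rewrite [LHS]row_sum_delta; apply: eq_bigr => k _; congr (_ *: _).
  by rewrite -eqf !mxE.
rewrite mulmx_suml (dactm_diag A_parity ndL rho_neq0 pL ratioL starE).
apply: eq_bigr => k _; congr (_ *: _ *m _).
move: ((f *m T) 0 k) => {eqf}f; apply/eqP; rewrite -subr_eq0; apply/eqP.
apply: (@lowering_adjoint_eq0 _ (L k) (fun f => diag_op A D k f - polyop q (scalar_op k) f)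
   (fun g => diag_star A star k g - polyop q (scalar_op k) g)) => //.
- move=> {}f g; rewrite mulrBl mulrBr !linearB /= aD; congr (_ - _).
  exact: (polyop_adjoint q (second_order_sym (kappa k) (@pL k))).
- move=> m g sg; have := triangularB (tD k) (triangular_polyop q (scalar_op_triangular k)) sg.
  by rewrite eigE horner_comp subrr.
- move=> m g sg; apply: leq_trans (size_polyD _ _) _; rewrite size_polyN geq_max sS//.
  exact: (triangular_leq (triangular_polyop q (scalar_op_triangular k))).
Qed.

End Classification.

(** * From real to complex coefficients *)

Section Complexification.
Variable R : realType.
Local Notation C := (complex R).
Local Notation toC := (@RtoC R).

Lemma RtoC_is_zmod_morphism : zmod_morphism toC.
Proof. by move=> x y; rewrite /RtoC; congr Complex; rewrite ?subr0. Qed.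
HB.instance Definition _ := GRing.isZmodMorphism.Build R C toC RtoC_is_zmod_morphism.

Lemma RtoC_is_monoid_morphism : monoid_morphism toC.
Proof. by split=> // x y; rewrite /RtoC; congr Complex => /=; rewrite ?(mulr0, mul0r, subr0, addr0). Qed.
HB.instance Definition _ := GRing.isMonoidMorphism.Build R C toC RtoC_is_monoid_morphism.

Local Notation ReP := (map_poly (@complex.Re R)).
Local Notation ImP := (map_poly (@complex.Im R)).
Local Notation pC := (map_poly toC).

Lemma coef_ReP (p : {poly C}) k : (ReP p)`_k = complex.Re p`_k.
Proof. by rewrite coef_map_id0. Qed.

Lemma coef_ImP (p : {poly C}) k : (ImP p)`_k = complex.Im p`_k.
Proof. by rewrite coef_map_id0. Qed.

Lemma Re_sum (I : finType) (f : I -> C) : complex.Re (\sum_i f i) = \sum_i complex.Re (f i).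
Proof. by apply: (big_morph (@complex.Re R)) => // -[a b] [c d]. Qed.

Lemma Im_sum (I : finType) (f : I -> C) : complex.Im (\sum_i f i) = \sum_i complex.Im (f i).
Proof. by apply: (big_morph (@complex.Im R)) => // -[a b] [c d]. Qed.

Lemma ReP_mulC (f : {poly R}) (p : {poly C}) : ReP (p * pC f) = ReP p * f.
Proof.
apply/polyP => k; rewrite coef_ReP !coefM Re_sum; apply: eq_bigr => i _.
by rewrite coef_ReP coef_map; case: (p`_i) => x y; rewrite /= mulr0 subr0.
Qed.

Lemma ImP_mulC (f : {poly R}) (p : {poly C}) : ImP (p * pC f) = ImP p * f.
Proof.
apply/polyP => k; rewrite coef_ImP !coefM Im_sum; apply: eq_bigr => i _.
by rewrite coef_ImP coef_map; case: (p`_i) => x y; rewrite /= mulr0 add0r.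
Qed.

Lemma ReP_add (p q : {poly C}) : ReP (p + q) = ReP p + ReP q.
Proof.
by apply/polyP => k; rewrite coefD !coef_ReP coefD; case: (p`_k) => ? ?; case: (q`_k).
Qed.

Lemma ImP_add (p q : {poly C}) : ImP (p + q) = ImP p + ImP q.
Proof.
by apply/polyP => k; rewrite coefD !coef_ImP coefD; case: (p`_k) => ? ?; case: (q`_k).
Qed.

Lemma Re_mulrn (z : C) n : complex.Re (z *+ n) = complex.Re z *+ n.
Proof. by elim: n => // n IH; rewrite !mulrS -IH; case: z {IH} => ? ?; case: (_ *+ n). Qed.

Lemma Im_mulrn (z : C) n : complex.Im (z *+ n) = complex.Im z *+ n.
Proof. by elim: n => // n IH; rewrite !mulrS -IH; case: z {IH} => ? ?; case: (_ *+ n). Qed.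

Lemma ReP_deriv (p : {poly C}) : ReP p^`() = (ReP p)^`().
Proof. by apply/polyP => k; rewrite coef_deriv !coef_ReP coef_deriv Re_mulrn. Qed.

Lemma ImP_deriv (p : {poly C}) : ImP p^`() = (ImP p)^`().
Proof. by apply/polyP => k; rewrite coef_deriv !coef_ImP coef_deriv Im_mulrn. Qed.

Lemma ReP_scale c (p : {poly C}) :
  ReP (c *: p) = complex.Re c *: ReP p - complex.Im c *: ImP p.
Proof.
apply/polyP => k; rewrite coefB !coefZ !coef_ReP coef_ImP coefZ.
by case: c => ? ?; case: (p`_k).
Qed.

Lemma ImP_scale c (p : {poly C}) :
  ImP (c *: p) = complex.Re c *: ImP p + complex.Im c *: ReP p.
Proof.
apply/polyP => k; rewrite coefD !coefZ !coef_ImP coef_ReP coefZ.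
by case: c => ? ?; case: (p`_k).
Qed.

Lemma ReP_ImP_eq0 (p : {poly C}) : ReP p = 0 -> ImP p = 0 -> p = 0.
Proof.
move=> r i; apply/polyP => k; have := coef_ReP p k; have := coef_ImP p k.
by rewrite r i !coef0; case: (p`_k) => x y /= <- <-.
Qed.

Lemma size_ReP (p : {poly C}) : (size (ReP p) <= size p)%N.
Proof. exact: size_poly. Qed.

Lemma size_ImP (p : {poly C}) : (size (ImP p) <= size p)%N.
Proof. exact: size_poly. Qed.

Section Functional.
Variable l : {scalar {poly R}}.

Definition complexify (p : {poly C}) : C := Complex (l (ReP p)) (l (ImP p)).

Lemma complexify_is_linear : scalar complexify.
Proof.
move=> c p q; rewrite /complexify ReP_add ImP_add ReP_scale ImP_scale.
rewrite !linearD linearN !linearZ /=; case: c => x y; congr Complex => /=.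
by rewrite scalerN.
Qed.
HB.instance Definition _ := GRing.isLinear.Build C {poly C} C _ complexify complexify_is_linear.

Lemma complexify_mulC (p : {poly C}) f :
  complexify (p * pC f) = Complex (l (ReP p * f)) (l (ImP p * f)).
Proof. by rewrite /complexify ReP_mulC ImP_mulC. Qed.

Lemma complexify_pearson rho f1 : pearson l rho f1 -> pearson complexify (pC rho) (pC f1).
Proof.
move=> pl h; rewrite linearD /= ![pC _ * _]mulrC !complexify_mulC.
rewrite ReP_deriv ImP_deriv ![_ * f1]mulrC ![_ * rho]mulrC.
by congr Complex; rewrite /= -linearD /= pl.
Qed.

(** Over the complex numbers a vanishing value on [f * f] does not force [f = 0]. Testing against
    the real polynomials [Re f] and [Im f], which respect the degree bound, does. *)
Lemma complexify_nondegenerate : (forall p, l (p * p) = 0 -> p = 0) ->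
  nondegenerate complexify.
Proof.
move=> l0 n f sf H'; have H (g : {poly C}) : (size g <= n)%N -> complexify (f * g) = 0 := H' g.
have sR : (size (pC (ReP f)) <= n)%N by rewrite size_map_poly (leq_trans (size_ReP f)).
have sI : (size (pC (ImP f)) <= n)%N by rewrite size_map_poly (leq_trans (size_ImP f)).
apply: ReP_ImP_eq0; apply: l0.
  by have := H _ sR; rewrite complexify_mulC => -[].
by have := H _ sI; rewrite complexify_mulC => -[].
Qed.

End Functional.

Section Matrices.
Variables (N : nat) (A : 'M[R]_N) (l : 'I_N -> {scalar {poly R}}).
Hypothesis A_parity : forall i j, A i j != 0 -> ~~ odd i && odd j.
Hypothesis lpos : forall i p, p != 0 -> 0 < l i (p * p).

Local Notation AC := (map_mx toC A).
Local Notation lC := (fun i => complexify (l i) : {scalar {poly C}}).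

Lemma l_sqr_eq0 i p : l i (p * p) = 0 -> p = 0.
Proof. by move=> e; apply/eqP; apply: contraT => /(@lpos i); rewrite e ltxx. Qed.

Lemma l_sqr_ge0 i p : 0 <= l i (p * p).
Proof. by have [->|/(@lpos i)/ltW//] := eqVneq p 0; rewrite mul0r linear0. Qed.

Lemma form_pos_eq0 (v : 'rV[{poly R}]_N) : form A l v v = 0 -> v = 0.
Proof.
move=> /eqP; rewrite psumr_eq0 => [/allP e|i _]; last exact: l_sqr_ge0.
have vT0 : v *m Tmx A = 0.
  apply/rowP => k; rewrite [RHS]mxE; apply: (@l_sqr_eq0 k); apply/eqP.
  by apply: (e k); rewrite mem_index_enum.
by rewrite -[v]mulmx1 -(Tmx_inv A_parity) mulmxA vT0 mul0mx.
Qed.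

Lemma form_real_nondegenerate n (v : 'rV[{poly R}]_N) : row_size_leq n v ->
  (forall g, row_size_leq n g -> form A l v g = 0) -> v = 0.
Proof. by move=> sv H; apply: form_pos_eq0; apply: H. Qed.

Lemma map_Tmx : map_mx pC (Tmx A) = Tmx AC.
Proof.
apply/matrixP => i j; rewrite !mxE rmorphD rmorphM /= map_polyX map_polyC /=.
by rewrite rmorph_nat.
Qed.

Lemma ReP_mulmx (v : 'rV[{poly C}]_N) (B : 'M[{poly R}]_N) :
  map_mx ReP (v *m map_mx pC B) = map_mx ReP v *m B.
Proof.
apply/rowP => k; rewrite !mxE.
rewrite (big_morph ReP ReP_add (_ : ReP 0 = 0)); last by apply/polyP => i; rewrite coef_ReP !coef0.
by apply: eq_bigr => i _; rewrite !mxE ReP_mulC.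
Qed.

Lemma ImP_mulmx (v : 'rV[{poly C}]_N) (B : 'M[{poly R}]_N) :
  map_mx ImP (v *m map_mx pC B) = map_mx ImP v *m B.
Proof.
apply/rowP => k; rewrite !mxE.
rewrite (big_morph ImP ImP_add (_ : ImP 0 = 0)); last by apply/polyP => i; rewrite coef_ImP !coef0.
by apply: eq_bigr => i _; rewrite !mxE ImP_mulC.
Qed.

Lemma form_complexify (v : 'rV[{poly C}]_N) (g : 'rV[{poly R}]_N) :
  form AC lC v (map_mx pC g) =
  Complex (form A l (map_mx ReP v) g) (form A l (map_mx ImP v) g).
Proof.
transitivity (\sum_i complexify (l i)
    ((v *m map_mx pC (Tmx A)) 0 i * pC ((g *m Tmx A) 0 i))).
  by apply: eq_bigr => i _; rewrite -map_Tmx -map_mxM [map_mx pC (g *m _) 0 i]mxE.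
under eq_bigr => i _ do rewrite complexify_mulC.
apply/eqP; rewrite eq_complex Re_sum Im_sum /=; apply/andP; split; apply/eqP/eq_bigr => i _ /=.
  by rewrite -ReP_mulmx [in RHS]mxE.
by rewrite -ImP_mulmx [in RHS]mxE.
Qed.

(** Testing against [Re v] and [Im v] reduces to the positivity of the real form. *)
Lemma form_complex_nondegenerate n (v : 'rV[{poly C}]_N) : row_size_leq n v ->
  (forall g, row_size_leq n g -> form AC lC v g = 0) -> v = 0.
Proof.
move=> sv H.
have sR : row_size_leq n (map_mx ReP v).
  by move=> j; rewrite mxE (leq_trans (size_ReP _)).
have sI : row_size_leq n (map_mx ImP v).
  by move=> j; rewrite mxE (leq_trans (size_ImP _)).
have sC (g : 'rV[{poly R}]_N) : row_size_leq n g -> row_size_leq n (map_mx pC g).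
  by move=> sg j; rewrite mxE size_map_poly.
have := H _ (sC _ sR); rewrite form_complexify => -[/form_pos_eq0 r _].
have := H _ (sC _ sI); rewrite form_complexify => -[_ /form_pos_eq0 i].
apply/rowP => k; rewrite [RHS]mxE; apply: ReP_ImP_eq0.
  by have := congr1 (fun u : 'rV[{poly R}]_N => u 0 k) r; rewrite !mxE.
by have := congr1 (fun u : 'rV[{poly R}]_N => u 0 k) i; rewrite !mxE.
Qed.

Lemma monic_orthogonal_complexify P :
  monic_orthogonal A l P -> monic_orthogonal AC lC (fun n => mxpC (P n)).
Proof.
move=> mo n; have [m o] := mo n; split=> [i j|i g sg].
  have -> : mxpC (P n) i j - (i == j)%:R *: 'X^n = pC (P n i j - (i == j)%:R *: 'X^n).
    by rewrite mxE rmorphB /= map_polyZ map_polyXn rmorph_nat.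
  by rewrite size_map_poly; apply: m.
have -> : row i (mxpC (P n)) = map_mx pC (row i (P n)) by apply/rowP => j; rewrite !mxE.
rewrite formC form_complexify formC o ?[form _ _ _ (row _ _)]formC ?o// => j; rewrite mxE.
  by rewrite (leq_trans (size_ImP _)).
by rewrite (leq_trans (size_ReP _)).
Qed.

End Matrices.
End Complexification.

(** * From integrals against the weight matrix to moment functionals *)

Section Transfer.
Variables (R : realType) (N : nat) (A : 'M[R]_N).
Variables (w : 'I_N -> R -> R) (I : set R) (l : 'I_N -> {scalar {poly R}}).
Local Notation mu := (@lebesgue_measure R).
Hypothesis mI : measurable I.
Hypothesis integrable_w : forall i (p : {poly R}),
  mu.-integrable I (fun x => (p.[x] * w i x)%:E).
Hypothesis lE : forall i (p : {poly R}),
  (\int[mu]_(x in I) (p.[x] * w i x)%:E = (l i p)%:E)%E.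

(** The factorization of [W] through [T] turns each matrix integrand into polynomials times scalar
    weights, to which the moment functionals apply. *)
Lemma weight_entry (P : 'M[{poly R}]_N) k i j x :
  (mxpeval P x *m Wfun A w x) i j * x ^+ k =
  \sum_s ((P *m Tmx A) i s * ('X^k * Tmx A j s)).[x] * w s x.
Proof.
have TE : Tfun A x = mxpeval (Tmx A) x.
  by apply/matrixP => a b; rewrite !mxE !hornerE /= hornerMn hornerC.
have PT : mxpeval P x *m Tfun A x = mxpeval (P *m Tmx A) x.
  apply/matrixP => a b; rewrite TE !mxE horner_sum; apply: eq_bigr => s _.
  by rewrite !mxE hornerM.
rewrite /Wfun !mulmxA PT mxE mulr_suml; apply: eq_bigr => s _.
rewrite TE mul_mx_diag !mxE !hornerM hornerXn; ring.
Qed.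

Lemma weight_entry_integral (P : 'M[{poly R}]_N) k i j :
  mu.-integrable I (fun x => ((mxpeval P x *m Wfun A w x) i j * x ^+ k)%:E) /\
  (\int[mu]_(x in I) ((mxpeval P x *m Wfun A w x) i j * x ^+ k)%:E =
   (form A l (row i P) ('X^k *: delta_mx 0 j))%:E)%E.
Proof.
pose h s x := (((P *m Tmx A) i s * ('X^k * Tmx A j s)).[x] * w s x)%:E.
have E : (fun x => ((mxpeval P x *m Wfun A w x) i j * x ^+ k)%:E) =
    (fun x => (\sum_s h s x)%E).
  by apply/funext => x; rewrite weight_entry -sumEFin.
have ih s : mu.-integrable I (h s) by apply: integrable_w.
split; first by rewrite E; apply: integrable_sum.
rewrite (_ : (fun x : R => _) = (fun x => (\sum_s h s x)%E)) ?E//.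
rewrite integral_sum// -sumEFin; apply: eq_bigr => s _.
rewrite lE; congr (_%:E); congr (l s _).
by rewrite scale_eT -row_mul [row _ _ 0 s]mxE.
Qed.

Lemma monic_OPS_orthogonal P :
  monic_OPS (Wfun A w) I P <-> monic_orthogonal A l P.
Proof.
split=> mo n; have [m o] := mo n; split=> //.
  move=> i g sg.
  have -> : g = \sum_j \sum_(k < n) ((g 0 j)`_k)%:P *: ('X^k *: delta_mx 0 j).
    rewrite [LHS]row_sum_delta; apply: eq_bigr => j _.
    rewrite -[g 0 j in LHS]coefK /= poly_def (big_ord_widen n (fun k => (g 0 j)`_k *: 'X^k) (sg j)).
    rewrite big_mkcond scaler_suml; apply: eq_bigr => k _.
    rewrite scalerA mul_polyC; case: ltnP => // kg.
    by rewrite nth_default// !scale0r.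
  rewrite form_sumr big1// => j _; rewrite form_sumr big1// => k _.
  rewrite formZr; have [_] := o k (ltn_ord k) i j.
  by rewrite (weight_entry_integral _ _ _ _).2 => -[->]; rewrite mulr0.
move=> k kn i j; have [ik ek] := weight_entry_integral (P n) k i j.
split=> //; rewrite ek o// => s; rewrite !mxE eqxx /=.
by case: (s == j); rewrite ?mulr1 ?mulr0 ?size_poly0// size_polyXn.
Qed.

Variables (rho : {poly R}) (f1 : 'I_N -> {poly R}) (kt : R) (l0 : 'I_N).
Local Notation C := (complex R).
Local Notation toC := (@RtoC R).
Local Notation pC := (map_poly toC).
Hypothesis A_parity : forall i j, A i j != 0 -> ~~ odd i && odd j.
Hypothesis A_chain : forall i j : 'I_N, j = i.+1 :> nat -> (A i j != 0) || (A j i != 0).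
Hypothesis l0_eq0 : l0 = 0%N :> nat.
Hypothesis lpos : forall i p, p != 0 -> 0 < l i (p * p).
Hypothesis lpearson : forall i, pearson (l i) rho (f1 i).
Hypotheses (rho_neq0 : rho != 0) (srho : (size rho <= 3)%N).
Hypothesis sf1 : forall i, (size (f1 i) <= 2)%N.
Hypothesis f1_shift : forall i j, A i j != 0 -> (f1 i)`_1 = (f1 j)`_1 + rho`_2 *+ 2.
Hypothesis kt_shift : forall i j, A i j != 0 -> kt + (f1 j)`_1 = 0.
Hypothesis ratioC : forall i j, i != j -> forall u v : {poly C}, u != 0 -> v != 0 ->
  ratio_poly (pC rho) (pC (f1 i)) (pC (f1 j)) u v != 0.
Hypothesis eigenC : forall m d V mu, triangular (diffop m d) mu ->
  adjoint_pair (complexify (l l0)) (diffop m d) V ->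
  (forall n (g : {poly C}), (size g <= n)%N -> (size (V g) <= n)%N) ->
  exists q, forall n, mu n =
    q.[(pC rho)`_2 * (n * n.-1)%:R + (pC (f1 l0))`_1 * n%:R].

Theorem transfer : thm_conclusion A w I rho f1 kt.
Proof.
pose AC := map_mx toC A.
pose lC i : {scalar {poly C}} := complexify (l i).
(* Along a nonzero [A i j], with [i] even and [j] odd, [kappa i] is zero and [kappa j] is [kt]. The
   eigenvalue shift thus forces [kt] to be minus the coefficient of degree one of [f1 j]. *)
pose kap (i : 'I_N) := toC (kt * (odd i)%:R).
pose fC i := pC (f1 i).
pose D := conj_diag_op AC (pC rho) fC kap.
have toC0 (x : R) : (toC x == 0) = (x == 0) by rewrite fmorph_eq0.
have ACE i j : AC i j = toC (A i j) by rewrite mxE.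
have parC i j : AC i j != 0 -> ~~ odd i && odd j by rewrite ACE toC0; apply: A_parity.
have chainC (i j : 'I_N) : j = i.+1 :> nat -> (AC i j != 0) || (AC j i != 0).
  by rewrite !ACE !toC0; apply: A_chain.
have ndC i : nondegenerate (lC i).
  by apply: complexify_nondegenerate => p; apply: l_sqr_eq0.
have ndf n v : row_size_leq n v ->
    (forall g, row_size_leq n g -> form AC lC v g = 0) -> v = 0.
  exact: (form_complex_nondegenerate A_parity lpos).
have srC : (size (pC rho) <= 3)%N by rewrite size_map_poly.
have sfC i : (size (fC i) <= 2)%N by rewrite size_map_poly.
have pC_ i : pearson (lC i) (pC rho) (fC i) by apply: complexify_pearson.
have shC i j : AC i j != 0 -> (fC i)`_1 = (fC j)`_1 + (pC rho)`_2 *+ 2.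
  rewrite ACE toC0 => Aij; rewrite !coef_map /= (f1_shift Aij).
  by rewrite rmorphD rmorphMn.
have kaC i j : AC i j != 0 -> kap i = kap j + (fC j)`_1.
  rewrite ACE toC0 => Aij; have /andP[oi oj] := A_parity Aij.
  by rewrite /kap coef_map -rmorphD (negbTE oi) oj mulr1 mulr0 (kt_shift Aij).
have TCE : mxpC (Tpoly A) = Tmx AC by exact: map_Tmx.
have TinvC : invmx (Tmx AC) = Tinvmx AC := invmx_Tmx parC.
have BopE (G : 'M[{poly C}]_N) :
    dact G (Bop rho f1 kt) = diag_act (pC rho) fC kap G.
  rewrite /dact /Bop /= !big_ord_recr big_ord0 /= add0r; apply/matrixP => i j.
  rewrite /mxpC map_diag_mx map_scalar_mx mul_mx_diag mul_mx_scalar !mxE.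
  rewrite (bigD1 j)//= big1 => [|s sj].
    by rewrite !mxE !eqxx /scalar_op /second_order -mul_polyC /kap /=; case: odd; rewrite !map_polyC /=; ring.
  by rewrite !mxE (negbTE sj) mulr0 polyC0 rmorph0 mulr0.
have DE (G : 'M[{poly C}]_N) : dact G D = diag_act (pC rho) fC kap (G *m Tmx AC) *m Tinvmx AC.
  exact: (dactm_conj_diag_op parC).
exists D; split; [|split; [|split]].
- by move=> G; rewrite DE BopE TCE TinvC.
- split; last by move=> [|[|[|j]]] //= _; rewrite nth_default.
  rewrite /D /=; apply/eqP => /matrixP /(_ l0 l0); rewrite !mxE eqxx mulr1n.
  by move/eqP; rewrite map_poly_eq0; apply/negP.
- move=> P /monic_OPS_orthogonal mo n.
  exact: (conj_diag_op_eigen parC ndf srC sfC pC_ shC kaC (monic_orthogonal_complexify mo)).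
move=> D' hD'.
have [P mo] := monic_orthogonal_exists (form_real_nondegenerate A_parity lpos).
have eig n : exists Lam, dactm (mxpC (P n)) D' = map_mx polyC Lam *m mxpC (P n).
  by apply: hD'; apply/monic_OPS_orthogonal.
have rhoC0 : pC rho != 0 by rewrite map_poly_eq0.
have eig0 m d V nu : triangular (diffop m d) nu -> adjoint_pair (lC l0) (diffop m d) V ->
    (forall n (g : {poly C}), (size g <= n)%N -> (size (V g) <= n)%N) ->
    exists q, forall n, nu n = q.[(lam_poly (pC rho) fC kap l0).[n%:R]].
  move=> tE aE sV; have [q Hq] := eigenC tE aE sV; exists q => n.
  have k0 : kap l0 = 0 by rewrite /kap l0_eq0 mulr0 rmorph0.
  rewrite Hq /lam_poly k0.
  rewrite !(hornerD, hornerZ, hornerM, hornerX, hornerN, hornerC) natrM addr0.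
  suff -> : (n%:R : C) * (n%:R - 1) = n%:R * n.-1%:R by [].
  by case: n => [|n]; rewrite ?mul0r//= -[n.+1%:R]natr1 addrK.
have [q Hq] := eigenoperator_polynomial parC ndC ndf srC sfC pC_ shC kaC
  (monic_orthogonal_complexify mo) eig rhoC0 ratioC l0_eq0 chainC eig0.
exists q => G; exact: Hq.
Qed.

End Transfer.


(** * Moment functionals of the classical weights *)

Section ExhaustedIntegral.
Variables (R : realType) (I : set R) (a b : nat -> R).
Local Notation mu := (@lebesgue_measure R).
Local Notation J n := ([set` `[a n, b n]] : set R).
Hypothesis ab : forall n, a n < b n.
Hypothesis I_J : I = \bigcup_n J n.
Hypothesis nestedJ : forall m n, (m <= n)%N -> J m `<=` J n.

Lemma exhausted_measurable : measurable I.
Proof. by rewrite I_J; apply: bigcup_measurable. Qed.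

Lemma exhausted_sub n : J n `<=` I.
Proof. by rewrite I_J => x Jx; exists n. Qed.

Lemma continuous_within_exhausted (f : R -> R) n :
  (forall x, I x -> {for x, continuous f}) -> {within J n, continuous f}.
Proof.
move=> cf; apply: continuous_in_subspaceT => x; rewrite inE => Jx.
exact/cf/(exhausted_sub Jx).
Qed.

Lemma exhausted_measurable_fun (f : R -> R) :
  (forall x, I x -> {for x, continuous f}) -> measurable_fun I f.
Proof.
move=> cf; rewrite I_J; apply/measurable_fun_bigcup => // n.
by apply: subspace_continuous_measurable_fun => //; apply: continuous_within_exhausted.
Qed.

Lemma FTC2_exhausted (f F : R -> R) n :
  (forall x, I x -> {for x, continuous f}) ->
  (forall x, I x -> is_derive x 1 F (f x)) ->
  (\int[mu]_(x in J n) (f x)%:E = (F (b n) - F (a n))%:E)%E.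
Proof.
move=> cf dF.
have cF x : J n x -> {for x, continuous F}.
  move=> Jx; apply/differentiable_continuous/derivable1_diffP.
  by have [] := dF x (exhausted_sub Jx).
rewrite EFinB; apply: continuous_FTC2 => //; first exact: continuous_within_exhausted.
  split.
  - move=> x xab; have [|//] := dF x _; apply: (@exhausted_sub n).
    exact: subset_itv_oo_cc.
  - by apply/cvg_at_right_filter/cF; rewrite /= in_itv /= lexx ltW.
  - by apply/cvg_at_left_filter/cF; rewrite /= in_itv /= lexx ltW.
move=> x xab; rewrite derive1E; have [|_ ->//] := dF x _; apply: (@exhausted_sub n).
exact: subset_itv_oo_cc.
Qed.

(** Monotone convergence: the integral of [g] over each compact interval is [G (b n) - G (a n)], at
    most [2 M]. *)
Lemma bounded_primitive_integrable (g G : R -> R) (M : R) :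
  (forall x, I x -> {for x, continuous g}) ->
  (forall x, I x -> 0 <= g x) ->
  (forall x, I x -> is_derive x 1 G (g x)) -> (forall x, I x -> `|G x| <= M) ->
  mu.-integrable I (EFin \o g).
Proof.
move=> cg g0 dG GM; have mg := exhausted_measurable_fun cg.
apply/integrableP; split; first exact/measurable_EFinP.
apply: (@le_lt_trans _ _ (M + M)%:E); last exact: ltry.
have -> : (\int[mu]_(x in I) `|(EFin \o g) x| = \int[mu]_(x in I) (EFin \o g) x)%E.
  apply: eq_integral.
  by move=> x; rewrite inE => Ix /=; rewrite ger0_norm// g0.
have : (\int[mu]_(x in J n) (EFin \o g) x @[n --> \oo] -->
    \int[mu]_(x in \bigcup_n J n) (EFin \o g) x)%E.
  apply: ge0_nondecreasing_set_cvg_integral => //.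
  - by move=> m n mn; rewrite subsetEset; apply: nestedJ.
  - move=> n; apply/measurable_EFinP; apply: measurable_funS mg => //.
      exact: exhausted_measurable.
    exact: exhausted_sub.
  - by move=> n x /exhausted_sub Ix; rewrite lee_fin g0.
rewrite -I_J => cv; apply: (cvge_le _ cv) => //.
apply: nearW => n; rewrite FTC2_exhausted// lee_fin.
have Ia : I (a n) by apply: (@exhausted_sub n); rewrite /= in_itv /= lexx ltW.
have Ib : I (b n) by apply: (@exhausted_sub n); rewrite /= in_itv /= lexx ltW.
have := GM _ Ia; have := GM _ Ib; rewrite !ler_norml; lra.
Qed.

(** Over each [J n] the integral is a difference of end point values of [F]; dominated convergence,
    with [|f|] as majorant, passes to the limit. *)
Lemma integral_exhausted_eq0 (f F : R -> R) :
  (forall x, I x -> {for x, continuous f}) ->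
  (forall x, I x -> is_derive x 1 F (f x)) ->
  mu.-integrable I (EFin \o f) ->
  F (a n) @[n --> \oo] --> (0 : R) -> F (b n) @[n --> \oo] --> (0 : R) ->
  (\int[mu]_(x in I) (f x)%:E = 0)%E.
Proof.
move=> cf dF intf Fa Fb; have mf := exhausted_measurable_fun cf.
have mEf : measurable_fun I (EFin \o f) by apply/measurable_EFinP.
have mI := exhausted_measurable.
pose fn n := (EFin \o f) \_ (J n).
have [] := @dominated_convergence _ _ _ mu I mI fn (EFin \o f) (fun x => `|(f x)%:E|%E).
- move=> n; apply/measurable_restrict => //.
  by rewrite setIidr; [apply: measurable_funS mEf => //; exact: exhausted_sub|exact: exhausted_sub].
- exact: mEf.
- apply: aeW => x Ix; apply: cvg_near_cst.
  have := Ix; rewrite I_J => -[m _ Jm]; near=> n.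
  rewrite /fn /restrict /patch ifT// inE; apply: (nestedJ _ Jm).
  by near: n; exists m.
- exact: integrable_abse.
- apply: aeW => x n Ix; rewrite /fn /restrict /patch; case: ifP => // _.
  by rewrite /= normr0 lee_fin.
move=> _ _ cv.
have E n : (\int[mu]_(x in I) fn n x = (F (b n) - F (a n))%:E)%E.
  rewrite /fn -integral_mkcondr setIidr; last exact: exhausted_sub.
  exact: FTC2_exhausted.
move: cv; rewrite /mk_sequence (funext E) => cv.
apply: (cvg_unique _ cv) => //; apply: cvg_EFin; first exact: nearW.
by rewrite -[X in _ --> X](subr0 0); apply: cvgB.
Unshelve. all: by end_near.
Qed.

End ExhaustedIntegral.

(** * The moment functional of a weight with an explicit majorant *)

Section WeightFunctional.
Variables (R : realType) (I : set R) (a b : nat -> R).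
Local Notation mu := (@lebesgue_measure R).
Local Notation J n := ([set` `[a n, b n]] : set R).
Hypothesis ab : forall n, a n < b n.
Hypothesis I_J : I = \bigcup_n J n.
Hypothesis nestedJ : forall m n, (m <= n)%N -> J m `<=` J n.
Variables (w w1 g G : R -> R) (M : R) (rho f1 : {poly R}).
Hypothesis dw : forall x, I x -> is_derive x 1 w (w1 x).
Hypothesis pearson_w : forall x, I x -> rho.[x] * w1 x = (f1 - rho^`()).[x] * w x.
Hypothesis w_gt0 : forall x, I x -> 0 < w x.
Hypothesis cg : forall x : R, I x -> {for x, continuous g}.
Hypothesis g_ge0 : forall x, I x -> 0 <= g x.
Hypothesis dG : forall x, I x -> is_derive x 1 G (g x).
Hypothesis G_bounded : forall x, I x -> `|G x| <= M.
Hypothesis w_dominated : forall p : {poly R}, exists C, forall x, I x ->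
  `|p.[x]| * w x <= C * g x.
Hypothesis w_cvg_a : forall p : {poly R}, rho.[a n] * p.[a n] * w (a n) @[n --> \oo] --> (0 : R).
Hypothesis w_cvg_b : forall p : {poly R}, rho.[b n] * p.[b n] * w (b n) @[n --> \oo] --> (0 : R).

Let mI : measurable I := exhausted_measurable I_J.

Lemma continuous_poly_weight (p : {poly R}) x : I x ->
  {for x, continuous (fun x => p.[x] * w x)}.
Proof.
move=> Ix; apply: continuousM; last first.
  by apply/differentiable_continuous/derivable1_diffP; have [] := dw Ix.
by apply/differentiable_continuous/derivable1_diffP; have [] := is_derive_poly p x.
Qed.

(** The majorant [g] is integrable because it has a bounded primitive [G]; no integral has to be
    computed. *)
Lemma poly_weight_integrable (p : {poly R}) :
  mu.-integrable I (fun x => (p.[x] * w x)%:E).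
Proof.
have [C HC] := w_dominated p.
have ig := bounded_primitive_integrable ab I_J nestedJ cg g_ge0 dG G_bounded.
apply: (@le_integrable _ _ _ mu I mI _ (fun x => (C%:E * (EFin \o g) x)%E)).
- apply/measurable_EFinP; apply: (exhausted_measurable_fun I_J) => x.
  exact: continuous_poly_weight.
- move=> x Ix; rewrite /= lee_fin normrM [`|w x|]gtr0_norm ?w_gt0//.
  by apply: le_trans (HC x Ix) _; rewrite ler_norm.
- exact: integrableZl.
Qed.

(** [pearson_w] says [(rho w)' = f1 w], so the integrand is the derivative of [rho h w], whose
    boundary values tend to zero. *)
Lemma poly_weight_pearson (h : {poly R}) :
  (\int[mu]_(x in I) ((rho * h^`() + f1 * h).[x] * w x)%:E = 0)%E.
Proof.
apply: (@integral_exhausted_eq0 _ _ _ _ ab I_J nestedJ _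
   (fun x => (rho * h).[x] * w x)).
- by move=> x; apply: continuous_poly_weight.
- move=> x Ix; have dp := is_derive_poly (rho * h) x; have dwx := dw Ix.
  apply: is_derive_eq.
  have := pearson_w Ix.
  rewrite derivM !(hornerD, hornerM, hornerN) => e.
  rewrite -[LHS]/(rho.[x] * h.[x] * w1 x + w x * (rho^`().[x] * h.[x] + rho.[x] * h^`().[x])).
  by rewrite mulrAC e; ring.
- exact: poly_weight_integrable.
- by under eq_fun do rewrite hornerM; exact: w_cvg_a.
- by under eq_fun do rewrite hornerM; exact: w_cvg_b.
Qed.

Lemma poly_weight_sqr_ge0 (p : {poly R}) x : I x -> 0 <= (p * p).[x] * w x.
Proof. by move=> Ix; apply: mulr_ge0; [rewrite hornerM -expr2 sqr_ge0|exact/ltW/w_gt0]. Qed.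

(** Otherwise [J 0], an interval of positive length, would be covered by a null set and the finitely
    many roots of [p]. *)
Lemma poly_weight_sqr_neq0 (p : {poly R}) : p != 0 ->
  (\int[mu]_(x in I) ((p * p).[x] * w x)%:E != 0)%E.
Proof.
move=> p0; apply/eqP => i0.
have mf : measurable_fun I (fun x => ((p * p).[x] * w x)%:E).
  by have /integrableP[] := poly_weight_integrable (p * p).
have : (\int[mu]_(x in I) `|((p * p).[x] * w x)%:E| = 0)%E.
  rewrite -[RHS]i0; apply: eq_integral => x; rewrite inE => Ix /=.
  by rewrite ger0_norm// poly_weight_sqr_ge0.
move=> i1; have [Z [mZ Z0 subZ]] := (ae_eq_integral_abs mu mI mf).1 i1.
have fin : finite_set [set x | p.[x] = 0].
  apply: contrapT => inf; have [B Bp sB] := infinite_set_fset (size p) inf.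
  suff : (size (finmap.enum_fset B) < size p)%N by rewrite ltnNge sB.
  apply: (max_poly_roots p0 _ (finmap.fset_uniq B)).
  by apply/allP => x xB; apply/rootP; apply: (Bp x).
have sub : J 0%N `<=` Z `|` [set x | p.[x] = 0].
  move=> x Jx; have [|nz] := eqVneq p.[x] 0; first by right.
  left; apply: subZ => /(_ (exhausted_sub I_J Jx)) /= [] /eqP.
  by rewrite hornerM !mulf_eq0 (negbTE nz) /= gt_eqF// w_gt0//; apply: exhausted_sub I_J _ _ Jx.
have : (mu (J 0%N) <= 0)%E.
  have mr : measurable [set x | p.[x] = 0].
    by apply: countable_measurable => [t|]; [exact: measurable_set1|exact: finite_set_countable].
  apply: (@le_trans _ _ (mu (Z `|` [set x | p.[x] = 0]))).
    by apply: le_measure => //; rewrite inE //; apply: measurableU.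
  rewrite measureU0 ?Z0//; apply: countable_lebesgue_measure0.
  exact: finite_set_countable.
rewrite lebesgue_measure_itv /= lte_fin ab -EFinB lee_fin; have := ab 0%N; lra.
Qed.

Lemma weight_functional : exists l : {scalar {poly R}},
  [/\ forall p : {poly R}, (\int[mu]_(x in I) (p.[x] * w x)%:E = (l p)%:E)%E,
      pearson l rho f1 & forall p, p != 0 -> 0 < l (p * p)].
Proof.
pose lf (p : {poly R}) : R := (\int[mu]_(x in I) (p.[x] * w x))%R.
have lfE p : (\int[mu]_(x in I) (p.[x] * w x)%:E = (lf p)%:E)%E.
  rewrite /lf /Rintegral fineK//; apply: integrable_fin_num => //.
  exact: poly_weight_integrable.
have lin : scalar lf.
  move=> c p q; apply: EFin_inj; rewrite -lfE EFinD EFinM -!lfE.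
  rewrite -integralZl//; last exact: poly_weight_integrable.
  rewrite -integralD//; last 2 first.
  - by apply: integrableZl => //; exact: poly_weight_integrable.
  - exact: poly_weight_integrable.
  apply: eq_integral => x _; rewrite -EFinM -EFinD; congr (_%:E).
  by rewrite hornerD hornerZ mulrDl mulrA.
pose lm := GRing.isLinear.Build R {poly R} R _ lf lin.
pose l : {scalar {poly R}} := HB.pack lf lm.
exists l; split => [p|h|p p0]; first exact: lfE.
  by apply: EFin_inj; rewrite -[l _]/(lf _) -lfE poly_weight_pearson.
rewrite -[l _]/(lf _) lt_def; apply/andP; split.
  by have := poly_weight_sqr_neq0 p0; rewrite lfE eqe.
rewrite -lee_fin -lfE; apply: integral_ge0 => x Ix.
by rewrite lee_fin poly_weight_sqr_ge0.
Qed.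

End WeightFunctional.

(** * Growth and limit estimates *)

Section GrowthBounds.
Variable R : realType.
Implicit Types (p : {poly R}) (x y : R).

(** For [k >= 1] the constant is [k^k]: raise [1 + y <= k (1 + y/k) <= k exp(y/k)] to the power
    [k]. *)
Lemma exp_dominates_power k : exists2 C : R, 0 <= C &
  forall y, 0 <= y -> (1 + y) ^+ k <= C * expR y.
Proof.
case: k => [|k].
  by exists 1 => // y y0; rewrite expr0 mul1r -expR0 ler_expR.
exists (k.+1%:R ^+ k.+1) => [|y y0]; first exact: exprn_ge0.
have k0 : 0 < k.+1%:R :> R by [].
have -> : expR y = expR (y / k.+1%:R) ^+ k.+1.
  by rewrite -expRM_natl; congr expR; field.
rewrite -exprMn; apply: lerXn2r; rewrite ?nnegrE ?addr_ge0 ?mulr_ge0 ?expR_ge0//.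
have h : k.+1%:R * (1 + y / k.+1%:R) <= k.+1%:R * expR (y / k.+1%:R).
  by rewrite ler_pM2l// expR_ge1Dx.
apply: le_trans h; rewrite mulrDr mulr1 mulrCA divff ?gt_eqF// mulr1 lerD2r.
by rewrite ler1n.
Qed.

Lemma poly_dominated p k : exists2 C : R, 0 <= C &
  forall x, `|p.[x]| * (1 + `|x|) ^+ k <= C * expR `|x|.
Proof.
have [C C0 HC] := exp_dominates_power (size p + k).
pose S := \sum_(i < size p) `|p`_i|.
have S0 : 0 <= S by apply: sumr_ge0.
exists (S * C) => [|x]; first exact: mulr_ge0.
have h1 : 1 <= 1 + `|x| by rewrite lerDl.
have h0 : 0 <= 1 + `|x| by rewrite (le_trans ler01).
rewrite -mulrA; apply: le_trans (ler_wpM2l S0 (HC _ (normr_ge0 x))).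
rewrite exprD mulrA; apply: ler_wpM2r; first exact: exprn_ge0.
rewrite horner_coef; apply: le_trans (ler_norm_sum _ _ _) _.
rewrite mulr_suml; apply: ler_sum => i _; rewrite normrM normrX.
apply: ler_wpM2l => //; apply: (@le_trans _ _ ((1 + `|x|) ^+ i)).
  by apply: lerXn2r; rewrite ?nnegrE// lerDr.
by apply: ler_weXn2l => //; apply: ltnW.
Qed.

Lemma dominated_cvg0 (u v : nat -> R) (C : R) :
  (forall n, `|u n| <= C * v n) -> v n @[n --> \oo] --> (0 : R) ->
  u n @[n --> \oo] --> (0 : R).
Proof.
move=> uv v0.
have Cv : C * v n @[n --> \oo] --> (0 : R).
  by rewrite -[X in _ --> X](mulr0 C); apply: cvgMr.
apply: (@squeeze_cvgr _ _ _ _ (fun n => - (C * v n)) (fun n => C * v n)) => //.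
  by apply: nearW => n; rewrite -ler_norml.
by rewrite -[X in _ --> X]oppr0; apply: cvgN.
Qed.

Lemma invnS_cvg0 : (n.+2%:R^-1 : R) @[n --> \oo] --> (0 : R).
Proof.
by have := @cvg_harmonic R; rewrite -cvg_shiftS.
Qed.

Lemma powR_invnS_cvg0 (s : R) : 0 < s -> (n.+2%:R^-1 `^ s) @[n --> \oo] --> (0 : R).
Proof.
move=> s0; apply: (@cvg_comp _ _ _ (fun n => n.+2%:R^-1 : R) (fun t => t `^ s) _ _ _ _ (powR_cvg0 s0)).
move=> B; rewrite /at_right /within /= => /invnS_cvg0 H.
have {}H : \forall n \near \oo, 0 < (n.+2%:R^-1 : R) -> B n.+2%:R^-1 by exact: H.
suff : \forall n \near \oo, B n.+2%:R^-1 by [].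
by apply: filterS H => n; apply; rewrite invr_gt0.
Qed.

Lemma is_derive_continuous (f : R -> R) x df : is_derive x 1 f df -> {for x, continuous f}.
Proof. by move=> [df' _]; apply/differentiable_continuous/derivable1_diffP. Qed.

Lemma is_derive_powR_comp (u : R -> R) x du s : 0 < u x -> is_derive x 1 u du ->
  is_derive x 1 (fun y => u y `^ s) (s * u x `^ (s - 1) * du).
Proof. by move=> ux d; apply: (is_derive1_comp (is_derive1_powR s ux) d). Qed.

Lemma powRS (x s : R) : 0 < x -> x `^ (s + 1) = x * x `^ s.
Proof.
move=> x0; rewrite powRD; last by rewrite (gt_eqF x0) implybT.
by rewrite powRr1 ?ltW// mulrC.
Qed.

Lemma powRP (x s : R) : 0 < x -> x * x `^ (s - 1) = x `^ s.
Proof. by move=> x0; rewrite -powRS// subrK. Qed.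

End GrowthBounds.

(** * Compact exhaustions of the three domains *)

Section Exhaustions.
Variable R : realType.
Local Notation inv2 n := (n.+2%:R^-1 : R).

Lemma line_exhausted : [set: R] = \bigcup_n [set` `[- n.+1%:R, n.+1%:R]].
Proof.
apply/seteqP; split=> // x _; exists (Num.truncn `|x|) => //=.
by rewrite in_itv /= -ler_norml ltW// truncnS_gt.
Qed.

Lemma inv2_gt0 n : 0 < inv2 n. Proof. by rewrite invr_gt0. Qed.

Lemma inv2_le m n : (m <= n)%N -> inv2 n <= inv2 m.
Proof. by move=> mn; rewrite lef_pV2 ?posrE// ler_nat. Qed.

Lemma inv2_lt1 n : inv2 n < 1.
Proof. by rewrite invf_lt1// ltr1n. Qed.

Lemma inv2_small x : 0 < x -> inv2 (Num.truncn x^-1) <= x.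
Proof.
move=> x0; rewrite -[leRHS]invrK lef_pV2 ?posrE ?invr_gt0//.
apply: le_trans (ltW (truncnS_gt _)) _; by rewrite ler_nat.
Qed.

(** The end points start at [1/2] and [2] because every interval, the one for [n = 0] included, must
    have positive length; [1/(n+1)] would begin with a single point. *)
Lemma half_line_exhausted :
  [set x : R | 0 < x] = \bigcup_n [set` `[inv2 n, n.+2%:R]].
Proof.
apply/seteqP; split=> [x /= x0|x [n _]]; last first.
  by rewrite /= in_itv /= => /andP[+ _]; apply: lt_le_trans; apply: inv2_gt0.
exists (maxn (Num.truncn x^-1) (Num.truncn x)) => //=; rewrite in_itv /=; apply/andP; split.
  by apply: le_trans (inv2_small x0); apply: inv2_le; rewrite leq_maxl.
apply: le_trans (ltW (truncnS_gt _)) _; rewrite ler_nat.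
by rewrite ltnS (leq_trans (leq_maxr (Num.truncn x^-1) _)).
Qed.

Lemma interval_exhausted :
  [set x : R | -1 < x < 1] = \bigcup_n [set` `[-1 + inv2 n, 1 - inv2 n]].
Proof.
apply/seteqP; split=> [x /= /andP[x0 x1]|x [n _]]; last first.
  rewrite /= in_itv /=; move: (inv2_gt0 n); set t := inv2 n => t0 /andP[h1 h2].
  by apply/andP; split; lra.
have y0 : 0 < x + 1 by lra.
have z0 : 0 < 1 - x by lra.
exists (maxn (Num.truncn (x + 1)^-1) (Num.truncn (1 - x)^-1)) => //=.
set m := maxn _ _.
have h1 : inv2 m <= x + 1 by apply: le_trans (inv2_small y0); apply: inv2_le; rewrite leq_maxl.
have h2 : inv2 m <= 1 - x by apply: le_trans (inv2_small z0); apply: inv2_le; rewrite leq_maxr.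
rewrite in_itv /=; set t := inv2 m in h1 h2 *; by apply/andP; split; lra.
Qed.

End Exhaustions.

(** * Moments of the Hermite, Laguerre and Jacobi weights *)

Section ClassicalWeights.
Variable R : realType.
Local Notation mu := (@lebesgue_measure R).

Definition has_moment_functional (I : set R) (w : R -> R) (rho f1 : {poly R}) :=
  (forall p : {poly R}, mu.-integrable I (fun x => (p.[x] * w x)%:E)) /\
  exists l : {scalar {poly R}},
  [/\ forall p : {poly R}, (\int[mu]_(x in I) (p.[x] * w x)%:E = (l p)%:E)%E,
      pearson l rho f1 & forall p, p != 0 -> 0 < l (p * p)].

Lemma hermite_moments (b : R) :
  has_moment_functional setT (w_hermite b) (rho_hermite R) (f1_hermite b).
Proof.
pose a1 n : R := - n.+1%:R; pose b1 n : R := n.+1%:R.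
have ab n : a1 n < b1 n by rewrite /a1 /b1 gtrN.
have nest m n : (m <= n)%N -> [set` `[a1 m, b1 m]] `<=` [set` `[a1 n, b1 n]].
  move=> mn; apply: subset_itv; rewrite bnd_simp /a1 /b1 ?lerN2 ler_nat ltnS //.
pose w1 (x : R) : R := (- 2 * x + 2 * b) * w_hermite b x.
have dw (x : R) : is_derive x 1 (w_hermite b) (w1 x).
  have du : is_derive x 1 (horner ((2 * b)%:P * 'X - 'X * 'X)) (- 2 * x + 2 * b).
    apply: is_derive_eq; rewrite derivB !derivM derivC derivX.
    by rewrite !hornerE; ring.
  have := is_derive1_comp (is_derive_expR _) du.
  rewrite (_ : expR \o _ = w_hermite b); last first.
    by apply/funext => y; rewrite /w_hermite /= !hornerE; congr expR; ring.
  rewrite (_ : w1 x = expR ((2 * b)%:P * 'X - 'X * 'X).[x] * (- 2 * x + 2 * b))//.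
  by rewrite /w1 /w_hermite mulrC !hornerE; congr (expR _ * _); ring.
have bound (p : {poly R}) : exists2 C, 0 <= C &
    forall x : R, `|p.[x]| * w_hermite b x <= C * (1 + x ^+ 2)^-1.
  have [C C0 HC] := poly_dominated p 2.
  (* The maximum of [(2|b| + 1) t - t^2], which bounds the exponent of [exp |x|] times the weight at
     [t = |x|]. *)
  pose c := (2 * `|b| + 1) ^+ 2 / 4.
  exists (C * expR c) => [|x]; first by rewrite mulr_ge0 ?expR_ge0.
  have x2 : 0 < 1 + x ^+ 2 by rewrite ltr_wpDr ?sqr_ge0.
  rewrite ler_pdivlMr//.
  have h1 : 1 + x ^+ 2 <= (1 + `|x|) ^+ 2.
    by rewrite sqrrD expr1n mul1r real_normK ?num_real// lerD2r lerDl mulrn_wge0.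
  have h2 : expR `|x| * w_hermite b x <= expR c.
    rewrite -expRD ler_expR /c.
    have e1 : b * x <= `|b| * `|x| by rewrite -normrM ler_norm.
    have e2 : x ^+ 2 = `|x| ^+ 2 by rewrite real_normK ?num_real.
    rewrite e2; have := sqr_ge0 (`|x| - (2 * `|b| + 1) / 2); nra.
  have w0 : 0 <= w_hermite b x by apply: expR_ge0.
  apply: (@le_trans _ _ (`|p.[x]| * (1 + `|x|) ^+ 2 * w_hermite b x)).
    by rewrite mulrAC; apply: ler_wpM2r => //; apply: ler_wpM2l.
  apply: le_trans (ler_wpM2r w0 (HC x)) _.
  by rewrite -mulrA ler_wpM2l.
(* The majorant [1/(1 + x^2)] has the bounded primitive [atan]. *)
have dG (x : R) : is_derive x 1 (@atan R) ((1 + x ^+ 2)^-1) by apply: is_derive1_atan.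
have cg (x : R) : {for x, continuous (fun x : R => (1 + x ^+ 2)^-1)}.
  apply: continuousV; first by rewrite gt_eqF// ltr_wpDr ?sqr_ge0.
  apply: continuousD; first exact: cst_continuous.
  exact: exprn_continuous.
have lim (s : nat -> R) (p : {poly R}) : (forall n, s n ^+ 2 = n.+1%:R ^+ 2) ->
    (rho_hermite R).[s n] * p.[s n] * w_hermite b (s n) @[n --> \oo] --> (0 : R).
  move=> sE; have [C C0 HC] := bound p.
  apply: (@dominated_cvg0 _ _ (fun n => n.+1%:R^-1) C); last exact: cvg_harmonic.
  move=> n; rewrite /rho_hermite hornerC mul1r normrM [`|w_hermite _ _|]ger0_norm ?expR_ge0//.
  apply: le_trans (HC _) _; rewrite sE ler_wpM2l// lef_pV2 ?posrE ?ltr_wpDr ?sqr_ge0//.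
  by have := sqr_ge0 (n.+1%:R - 1 : R); nra.
have M0 (x : R) : setT x -> `|atan x| <= pi / 2.
  by move=> _; rewrite ler_norml !ltW ?atan_gtNpi2 ?atan_ltpi2.
have pw (x : R) : setT x -> (rho_hermite R).[x] * w1 x =
    (f1_hermite b - (rho_hermite R)^`()).[x] * w_hermite b x.
  move=> _; rewrite /rho_hermite /f1_hermite /w1 derivC subr0 hornerC.
  rewrite hornerD hornerN hornerM !hornerC hornerX.
  by ring.
have dom (p : {poly R}) : exists C, forall x : R, setT x ->
    `|p.[x]| * w_hermite b x <= C * (1 + x ^+ 2)^-1.
  by have [C _ HC] := bound p; exists C => x _.
have w0 (x : R) : setT x -> 0 < w_hermite b x by move=> _; apply: expR_gt0.
have g0 (x : R) : setT x -> 0 <= (1 + x ^+ 2)^-1 :> R.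
  by move=> _; rewrite invr_ge0 addr_ge0 ?sqr_ge0.
have la p := lim a1 p (fun n => sqrrN _).
have lb p := lim b1 p (fun n => erefl).
split.
  exact: (poly_weight_integrable ab (@line_exhausted R) nest (fun x _ => dw x)
    w0 (fun x _ => cg x) g0 (fun x _ => dG x) M0 dom).
exact: (weight_functional ab (@line_exhausted R) nest (fun x _ => dw x) pw
    w0 (fun x _ => cg x) g0 (fun x _ => dG x) M0 dom la lb).
Qed.

End ClassicalWeights.

Section LaguerreJacobi.
Variable R : realType.
Local Notation inv2 n := (n.+2%:R^-1 : R).

Lemma laguerre_moments (al : R) : -1 < al ->
  has_moment_functional [set x | 0 < x] (w_laguerre al) (rho_laguerre R) (f1_laguerre al).
Proof.
move=> al1; have s0 : 0 < al + 1 by lra.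
pose a1 n := inv2 n; pose b1 n : R := n.+2%:R.
have ab n : a1 n < b1 n.
  by apply: lt_trans (inv2_lt1 R n) _; rewrite /b1 ltr1n.
have nest m n : (m <= n)%N -> [set` `[a1 m, b1 m]] `<=` [set` `[a1 n, b1 n]].
  by move=> mn; apply: subset_itv; rewrite bnd_simp ?inv2_le// /b1 ler_nat !ltnS.
pose w1 (x : R) : R := (al - x) * (expR (- x) * x `^ (al - 1)).
have dw (x : R) : 0 < x -> is_derive x 1 (w_laguerre al) (w1 x).
  move=> x0; have d1 := is_derive1_comp (is_derive_expR _) (is_deriveNid x 1).
  have d2 := is_derive1_powR al x0.
  apply: is_derive_eq.
  rewrite -[LHS]/(expR (- x) * (al * x `^ (al - 1)) + x `^ al * (expR (- x) * - 1)).
  by rewrite -(powRP al x0) /w1; ring.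
(* [g] is the derivative of [G = (x/(1+x))^(al+1)], which stays in [[0, 1]]. It behaves like [x^al]
   at zero and decays like [x^-2] at infinity. *)
pose g (x : R) : R := (al + 1) * (x `^ al * (1 + x) `^ (- (al + 1) - 1)).
pose G (x : R) : R := x `^ (al + 1) * (1 + x) `^ (- (al + 1)).
have d1x (x : R) : is_derive x 1 (fun y : R => 1 + y) 1.
  have d := is_deriveD (is_derive_cst (1 : R) x (1 : R)) (is_derive_id x (1 : R)).
  by rewrite add0r in d; exact: d.
have dG (x : R) : 0 < x -> is_derive x 1 G (g x).
  move=> x0; have x1 : 0 < 1 + x by lra.
  have e1 := is_derive1_powR (al + 1) x0.
  have e2 := is_derive_powR_comp (- (al + 1)) x1 (d1x x).
  apply: is_derive_eq.
  rewrite -[LHS]/(x `^ (al + 1) * (- (al + 1) * (1 + x) `^ (- (al + 1) - 1) * 1) +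
    (1 + x) `^ (- (al + 1)) * ((al + 1) * x `^ (al + 1 - 1))).
  rewrite addrK (powRS al x0) -(powRP (- (al + 1)) x1) /g; ring.
have cg (x : R) : 0 < x -> {for x, continuous g}.
  move=> x0; have x1 : 0 < 1 + x by lra.
  apply: continuousM; first exact: cst_continuous.
  apply: continuousM; first exact: is_derive_continuous (is_derive1_powR al x0).
  exact: is_derive_continuous (is_derive_powR_comp _ x1 (d1x x)).
have g0 (x : R) : 0 < x -> 0 <= g x.
  by move=> x0; rewrite /g mulr_ge0 ?ltW// mulr_gt0 ?powR_gt0//; lra.
have G0 (x : R) : 0 < x -> 0 <= G x <= 1.
  move=> x0; have x1 : 0 < 1 + x by lra.
  rewrite /G mulr_ge0 ?powR_ge0//= powRN ler_pdivrMr ?powR_gt0// mul1r.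
  by apply: ge0_ler_powR; rewrite ?nnegrE; lra.
have M0 (x : R) : 0 < x -> `|G x| <= 1.
  by move=> /G0 /andP[h1 h2]; rewrite ger0_norm.
have w0 (x : R) : 0 < x -> 0 < w_laguerre al x.
  by move=> x0; rewrite mulr_gt0 ?expR_gt0 ?powR_gt0.
have bound (p : {poly R}) : exists2 C, 0 <= C &
    forall x : R, 0 < x -> `|p.[x]| * w_laguerre al x <= C * g x.
  have [C C0 HC] := poly_dominated p (Num.truncn (al + 1 + 1)).+1.
  exists (C / (al + 1)) => [|x x0]; first by rewrite divr_ge0// ltW.
  have x1 : 0 < 1 + x by lra.
  have h1 : (1 + x) `^ (al + 1 + 1) <= (1 + x) ^+ (Num.truncn (al + 1 + 1)).+1.
    rewrite -powR_mulrn ?(ltW x1)//; apply: ler_powR; first lra.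
    exact/ltW/truncnS_gt.
  have h2 : `|p.[x]| * (1 + x) `^ (al + 1 + 1) <= C * expR x.
    have := HC x; rewrite (gtr0_norm x0); apply: le_trans.
    exact: ler_wpM2l.
  have -> : C / (al + 1) * g x = C * expR x * (expR (- x) * x `^ al) / (1 + x) `^ (al + 1 + 1).
    rewrite /g -opprD powRN expRN; field.
    by rewrite !gt_eqF ?expR_gt0 ?powR_gt0.
  rewrite ler_pdivlMr ?powR_gt0// mulrAC /w_laguerre; apply: ler_wpM2r => //.
  by rewrite mulr_ge0 ?expR_ge0 ?powR_ge0.
(* One bound serves both ends: [G] tends to zero at [0], and [1/(1+x)] does at infinity. *)
have lim0 (p : {poly R}) : exists2 C, 0 <= C & forall x : R, 0 < x ->
    `|(rho_laguerre R).[x] * p.[x] * w_laguerre al x| <= C * (G x * (1 + x)^-1).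
  have [C C0 HC] := bound p; exists (C * (al + 1)) => [|x x0]; first by rewrite mulr_ge0// ltW.
  have x1 : 0 < 1 + x by lra.
  rewrite hornerX normrM (gtr0_norm (w0 x x0)) normrM (gtr0_norm x0) -mulrA.
  apply: le_trans (ler_wpM2l (ltW x0) (HC x x0)) _.
  rewrite le_eqVlt; apply/orP; left; apply/eqP.
  rewrite /g /G (powRS al x0) -(powRP (- (al + 1)) x1); field.
  by rewrite gt_eqF.
have la (p : {poly R}) :
    (rho_laguerre R).[a1 n] * p.[a1 n] * w_laguerre al (a1 n) @[n --> \oo] --> (0 : R).
  have [C C0 HC] := lim0 p.
  apply: (@dominated_cvg0 _ _ _ C); last exact: powR_invnS_cvg0 s0.
  move=> n; apply: le_trans (HC _ (inv2_gt0 R n)) _; apply: ler_wpM2l => //.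
  have x0 := inv2_gt0 R n; rewrite /G -mulrA ler_piMr ?powR_ge0//.
  have x1 : 1 <= 1 + a1 n by rewrite lerDl ltW.
  have q0 : 0 < 1 + a1 n by apply: lt_le_trans x1.
  apply: mulr_ile1; [exact: powR_ge0|by rewrite invr_ge0 ltW| |by rewrite invf_le1].
  rewrite powRN invf_le1 ?powR_gt0//.
  by have := ler_powR x1 (ltW s0); rewrite powRr0.
have lb (p : {poly R}) :
    (rho_laguerre R).[b1 n] * p.[b1 n] * w_laguerre al (b1 n) @[n --> \oo] --> (0 : R).
  have [C C0 HC] := lim0 p.
  apply: (@dominated_cvg0 _ _ (fun n => inv2 n) C); last exact: invnS_cvg0.
  move=> n; have b0 : 0 < b1 n by rewrite /b1.
  apply: le_trans (HC _ b0) _; apply: ler_wpM2l => //.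
  have /andP[h1 h2] := G0 _ b0.
  apply: (@le_trans _ _ (1 * (1 + b1 n)^-1)).
    by apply: ler_wpM2r => //; rewrite invr_ge0 addr_ge0// ltW.
  by rewrite mul1r lef_pV2 ?posrE ?addr_gt0// /b1 lerDr.
have pw (x : R) : 0 < x -> (rho_laguerre R).[x] * w1 x =
    (f1_laguerre al - (rho_laguerre R)^`()).[x] * w_laguerre al x.
  move=> x0; rewrite /rho_laguerre /f1_laguerre derivX /w1 /w_laguerre -(powRP al x0).
  by rewrite !(hornerD, hornerN, hornerC, hornerX); ring.
have dom (p : {poly R}) : exists C, forall x : R, 0 < x -> `|p.[x]| * w_laguerre al x <= C * g x.
  by have [C _ HC] := bound p; exists C.
split.
  exact: (poly_weight_integrable ab (@half_line_exhausted R) nest dw w0 cg g0 dG M0 dom).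
exact: (weight_functional ab (@half_line_exhausted R) nest dw pw w0 cg g0 dG M0 dom la lb).
Qed.

Lemma powR_le_exp2 (y s : R) : 1 <= y <= 2 -> y `^ s <= 2 `^ `|s|.
Proof.
move=> /andP[y1 y2]; apply: (@le_trans _ _ (y `^ `|s|)).
  by apply: ler_powR => //; exact: ler_norm.
by apply: ge0_ler_powR; rewrite ?nnegrE //; lra.
Qed.

Lemma jacobi_moments (al be : R) : -1 < al -> -1 < be ->
  has_moment_functional [set x | -1 < x < 1] (w_jacobi al be) (rho_jacobi R) (f1_jacobi al be).
Proof.
move=> al1 be1; have s0 : 0 < al + 1 by lra.
have t0 : 0 < be + 1 by lra.
pose a1 n : R := -1 + inv2 n; pose b1 n : R := 1 - inv2 n.
have ab n : a1 n < b1 n.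
  by rewrite /a1 /b1; have := inv2_lt1 R n; set t := inv2 n; lra.
have nest m n : (m <= n)%N -> [set` `[a1 m, b1 m]] `<=` [set` `[a1 n, b1 n]].
  by move=> mn; apply: subset_itv; rewrite bnd_simp /a1 /b1 ?lerD2l ?lerN2 inv2_le.
have pos (x : R) : -1 < x < 1 -> 0 < 1 - x /\ 0 < 1 + x.
  by move=> /andP[h1 h2]; split; lra.
have d1 (x : R) : is_derive x 1 (fun y : R => 1 - y) (- 1).
  have d := is_deriveB (is_derive_cst (1 : R) x (1 : R)) (is_derive_id x (1 : R)).
  by rewrite add0r in d; exact: d.
have d2 (x : R) : is_derive x 1 (fun y : R => 1 + y) 1.
  have d := is_deriveD (is_derive_cst (1 : R) x (1 : R)) (is_derive_id x (1 : R)).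
  by rewrite add0r in d; exact: d.
pose w1 (x : R) : R := (be * (1 - x) - al * (1 + x)) *
  ((1 - x) `^ (al - 1) * (1 + x) `^ (be - 1)).
have dw (x : R) : -1 < x < 1 -> is_derive x 1 (w_jacobi al be) (w1 x).
  move=> /pos[x0 x1].
  have e1 := @is_derive_powR_comp _ (fun y => 1 - y) x _ al x0 (d1 x).
  have e2 := is_derive_powR_comp be x1 (d2 x).
  apply: is_derive_eq.
  rewrite -[LHS]/((1 - x) `^ al * (be * (1 + x) `^ (be - 1) * 1) +
    (1 + x) `^ be * (al * (1 - x) `^ (al - 1) * - 1)).
  by rewrite -(powRP al x0) -(powRP be x1) /w1; ring.
(* Near each end point only one factor of the weight can be singular, so a multiple of this sum of
   one-sided powers, with elementary primitives, is a majorant. *)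
pose g (x : R) : R := (1 + x) `^ be + (1 - x) `^ al.
pose G (x : R) : R := (be + 1)^-1 * (1 + x) `^ (be + 1) - (al + 1)^-1 * (1 - x) `^ (al + 1).
have dG (x : R) : -1 < x < 1 -> is_derive x 1 G (g x).
  move=> /pos[x0 x1].
  have e1 := @is_derive_powR_comp _ (fun y => 1 - y) x _ (al + 1) x0 (d1 x).
  have e2 := is_derive_powR_comp (be + 1) x1 (d2 x).
  have e3 := is_deriveB (is_deriveZ (be + 1)^-1 e2) (is_deriveZ (al + 1)^-1 e1).
  apply: is_derive_eq e3 _.
  rewrite -[LHS]/((be + 1)^-1 * ((be + 1) * (1 + x) `^ (be + 1 - 1) * 1) -
    (al + 1)^-1 * ((al + 1) * (1 - x) `^ (al + 1 - 1) * - 1)).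
  by rewrite !addrK /g; field; rewrite !gt_eqF.
have cg (x : R) : -1 < x < 1 -> {for x, continuous g}.
  move=> /pos[x0 x1]; apply: continuousD.
    exact: is_derive_continuous (is_derive_powR_comp be x1 (d2 x)).
  exact: is_derive_continuous (@is_derive_powR_comp _ (fun y => 1 - y) x _ al x0 (d1 x)).
have g0 (x : R) : -1 < x < 1 -> 0 <= g x by move=> _; rewrite addr_ge0 ?powR_ge0.
have w0 (x : R) : -1 < x < 1 -> 0 < w_jacobi al be x.
  by move=> /pos[x0 x1]; rewrite mulr_gt0 ?powR_gt0.
have M0 (x : R) : -1 < x < 1 ->
    `|G x| <= (be + 1)^-1 * 2 `^ (be + 1) + (al + 1)^-1 * 2 `^ (al + 1).
  move=> xI; have [x0 x1] := pos x xI; move: xI => /andP[h1 h2].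
  rewrite /G; apply: le_trans (ler_normB _ _) _.
  rewrite !ger0_norm ?mulr_ge0 ?powR_ge0 ?invr_ge0 ?(ltW s0) ?(ltW t0)//.
  apply: lerD; rewrite ler_pM2l ?invr_gt0//; apply: ge0_ler_powR; rewrite ?nnegrE; lra.
have bnd (p : {poly R}) : exists2 C, 0 <= C & forall x : R, -1 < x < 1 -> `|p.[x]| <= C.
  have [C C0 HC] := poly_dominated p 0.
  exists (C * expR 1) => [|x xI]; first by rewrite mulr_ge0 ?expR_ge0.
  have := HC x; rewrite expr0 mulr1 => h; apply: le_trans h _.
  by apply: ler_wpM2l => //; rewrite ler_expR ler_norml; case/andP: xI => *; rewrite !ltW.
have dom (p : {poly R}) : exists C, forall x : R, -1 < x < 1 ->
    `|p.[x]| * w_jacobi al be x <= C * g x.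
  have [C C0 HC] := bnd p.
  exists (C * (2 `^ `|al| + 2 `^ `|be|)) => x xI; have [x0 x1] := pos x xI.
  rewrite -mulrA; apply: ler_pM => //; [exact/ltW/w0|exact: HC|].
  have A0 := powR_ge0 (1 - x) al; have B0 := powR_ge0 (1 + x) be.
  have A1 := powR_ge0 2 `|al|; have B1 := powR_ge0 2 `|be|.
  rewrite /w_jacobi /g; move: xI => /andP[h1 h2].
  (* On the right half [1 + x] lies in [[1, 2]], on the left half [1 - x] does, and powers of such a
     number are bounded whatever the sign of the exponent. *)
  have [xp|xn] := lerP 0 x.
    have h : (1 + x) `^ be <= 2 `^ `|be| by apply: powR_le_exp2; apply/andP; split; lra.
    by have := ler_wpM2l A0 h; nra.
  have h : (1 - x) `^ al <= 2 `^ `|al| by apply: powR_le_exp2; apply/andP; split; lra.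
  by have := ler_wpM2r B0 h; nra.
(* Multiplication by [rho] raises both exponents by one and makes them positive; hence the boundary
   terms vanish. *)
have rhoE (p : {poly R}) (x : R) : -1 < x < 1 -> (rho_jacobi R).[x] * p.[x] * w_jacobi al be x =
    p.[x] * ((1 - x) `^ (al + 1) * (1 + x) `^ (be + 1)).
  move=> /pos[x0 x1]; rewrite (powRS al x0) (powRS be x1) /w_jacobi /rho_jacobi.
  by rewrite hornerD hornerC hornerN hornerXn; ring.
have inI n : -1 < a1 n < 1 /\ -1 < b1 n < 1.
  rewrite /a1 /b1; have := inv2_lt1 R n; have := inv2_gt0 R n; set t := inv2 n => h1 h2.
  by split; apply/andP; split; lra.
have la (p : {poly R}) :
    (rho_jacobi R).[a1 n] * p.[a1 n] * w_jacobi al be (a1 n) @[n --> \oo] --> (0 : R).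
  have [C C0 HC] := bnd p.
  apply: (@dominated_cvg0 _ _ _ (C * 2 `^ (al + 1))); last exact: powR_invnS_cvg0 t0.
  move=> n; have [aI _] := inI n; rewrite rhoE// normrM -mulrA; apply: ler_pM => //.
    exact: HC.
  rewrite ger0_norm ?mulr_ge0 ?powR_ge0// [1 + a1 n]addrA subrr add0r.
  apply: ler_wpM2r; first exact: powR_ge0.
  by move: aI => /andP[h1 h2]; apply: ge0_ler_powR; rewrite ?nnegrE; lra.
have lb (p : {poly R}) :
    (rho_jacobi R).[b1 n] * p.[b1 n] * w_jacobi al be (b1 n) @[n --> \oo] --> (0 : R).
  have [C C0 HC] := bnd p.
  apply: (@dominated_cvg0 _ _ _ (C * 2 `^ (be + 1))); last exact: powR_invnS_cvg0 s0.
  move=> n; have [_ bI] := inI n; rewrite rhoE// normrM -mulrA; apply: ler_pM => //.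
    exact: HC.
  rewrite ger0_norm ?mulr_ge0 ?powR_ge0// mulrC.
  have -> : 1 - b1 n = inv2 n by rewrite /b1 opprB addrC subrK.
  apply: ler_wpM2r; first exact: powR_ge0.
  by move: bI => /andP[h1 h2]; apply: ge0_ler_powR; rewrite ?nnegrE; lra.
have pw (x : R) : -1 < x < 1 -> (rho_jacobi R).[x] * w1 x =
    (f1_jacobi al be - (rho_jacobi R)^`()).[x] * w_jacobi al be x.
  move=> /pos[x0 x1]; rewrite /rho_jacobi /f1_jacobi /w1 /w_jacobi -(powRP al x0) -(powRP be x1).
  rewrite derivB derivXn -[1]/(1%:P) derivC.
  by rewrite !(hornerD, hornerN, hornerC, hornerX, hornerM, hornerMn, hornerXn); ring.
split.
  exact: (poly_weight_integrable ab (@interval_exhausted R) nest dw w0 cg g0 dG M0 dom).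
exact: (weight_functional ab (@interval_exhausted R) nest dw pw w0 cg g0 dG M0 dom la lb).
Qed.

End LaguerreJacobi.

(** * The three families *)

Section Conclusion.
Variables (R : realType) (N : nat).
Local Notation C := (complex R).
Local Notation toC := (@RtoC R).
Local Notation pC := (map_poly toC).

Lemma Amx_parity (a : nat -> R) (i j : 'I_N) : Amx N a i j != 0 -> ~~ odd i && odd j.
Proof.
rewrite mxE; case: ifP => [/andP[oj /orP[/eqP ij|/eqP ij]] _|]; last by rewrite eqxx.
  by rewrite oj andbT; move: oj; rewrite -ij.
by rewrite oj ij /= oj.
Qed.

(** The parity of [i] decides which of the two entries is nonzero; its value is [a j], the larger
    index being [j]. *)
Lemma Amx_chain (a : nat -> R) (i j : 'I_N) :
  (forall k : nat, (1 <= k <= N.-1)%N -> a k != 0) -> j = i.+1 :> nat ->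
  (Amx N a i j != 0) || (Amx N a j i != 0).
Proof.
move=> ha ij; have aj : a j != 0.
  by apply: ha; have := ltn_ord j; rewrite ij /=; lia.
rewrite !mxE ij /= !eqxx /= orbT !andbT -ij.
have -> : maxn i j = j by apply/maxn_idPr; rewrite ij.
have -> : maxn j i = j by apply/maxn_idPl; rewrite ij.
by case: (odd i); rewrite aj ?orbT.
Qed.

Lemma classical_conclusion (a : nat -> R) (w : 'I_N -> R -> R) (I : set R)
    (rho : {poly R}) (f1 : 'I_N -> {poly R}) (kt : R) (l0 : 'I_N) :
  (forall k : nat, (1 <= k <= N.-1)%N -> a k != 0) -> l0 = 0%N :> nat -> measurable I ->
  (forall i, has_moment_functional I (w i) rho (f1 i)) ->
  rho != 0 -> (size rho <= 3)%N -> (forall i, (size (f1 i) <= 2)%N) ->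
  (forall i j : 'I_N, ~~ odd i -> odd j -> (f1 i)`_1 = (f1 j)`_1 + rho`_2 *+ 2) ->
  (forall j : 'I_N, odd j -> kt + (f1 j)`_1 = 0) ->
  (forall i j, i != j -> forall u v : {poly C}, u != 0 -> v != 0 ->
     ratio_poly (pC rho) (pC (f1 i)) (pC (f1 j)) u v != 0) ->
  (forall l : {scalar {poly C}}, pearson l (pC rho) (pC (f1 l0)) -> nondegenerate l ->
     forall m d V mu, triangular (diffop m d) mu -> adjoint_pair l (diffop m d) V ->
     (forall n (g : {poly C}), (size g <= n)%N -> (size (V g) <= n)%N) ->
     exists q : {poly C}, forall n, mu n =
       q.[(pC rho)`_2 * (n * n.-1)%:R + (pC (f1 l0))`_1 * n%:R]) ->
  thm_conclusion (Amx N a) w I rho f1 kt.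
Proof.
move=> ha l00 mI mom rho0 srho sf1 fs ks ratio eig.
have [l Hl] := choice (fun i => (mom i).2).
have lE i p : (\int[lebesgue_measure]_(x in I) (p.[x] * w i x)%:E = (l i p)%:E)%E.
  by have [h _ _] := Hl i; apply: h.
have lpear i : pearson (l i) rho (f1 i) by have [_ h _] := Hl i.
have lpos i p : p != 0 -> 0 < l i (p * p) by have [_ _ h] := Hl i; apply: h.
apply: (@transfer R N (Amx N a) w I l mI (fun i => (mom i).1) lE rho f1 kt l0) => //.
- by move=> i j; apply: Amx_parity.
- by move=> i j; apply: Amx_chain.
- by move=> i j /Amx_parity /andP[]; apply: fs.
- by move=> i j /Amx_parity /andP[_]; apply: ks.
- move=> m d V nu; apply: eig; first exact: complexify_pearson.
  by apply: complexify_nondegenerate => p; apply: l_sqr_eq0.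
Qed.

Lemma RtoC_eq0 (x : R) : (toC x == 0) = (x == 0).
Proof. by rewrite fmorph_eq0. Qed.

Lemma hermite_ratio (b c : R) (u v : {poly C}) : b != c -> u != 0 -> v != 0 ->
  ratio_poly (pC (rho_hermite R)) (pC (f1_hermite b)) (pC (f1_hermite c)) u v != 0.
Proof.
move=> bc; rewrite (_ : pC (rho_hermite R) = 1%:P); last by rewrite rmorph1.
apply: (@ratio_poly_const _ _ (toC (2 * b - 2 * c))).
  by rewrite RtoC_eq0 -mulrBr mulf_neq0 ?subr_eq0.
rewrite -rmorphB /= /f1_hermite opprB addrA subrK -polyCB.
by rewrite map_polyC.
Qed.

(** At the root [0] of [rho] the indicial factor is [z + b - c]. *)
Lemma laguerre_ratio (b c : R) (u v : {poly C}) : (forall z : int, b - c != z%:~R) ->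
  u != 0 -> v != 0 ->
  ratio_poly (pC (rho_laguerre R)) (pC (f1_laguerre b)) (pC (f1_laguerre c)) u v != 0.
Proof.
move=> bc; apply: (@ratio_poly_root _ _ 1 _ _ (toC 0)).
  by rewrite /rho_laguerre map_polyX rmorph0 subr0 mulr1.
move=> z; rewrite hornerC mul1r -(rmorph_int toC) !horner_map /= -rmorphB -rmorphD /= RtoC_eq0.
rewrite /f1_laguerre !(hornerD, hornerN, hornerC, hornerX).
by have := bc (- z); rewrite rmorphN /=; apply: contra => /eqP e; apply/eqP; lra.
Qed.

(** The [alpha] are compared at the root [1] and the [beta] at [-1]. There [f1] takes the values
    [-2 (alpha + 1)] and [2 (beta + 1)], and the cofactor of the root in [rho] the values [-2] and
    [2]. *)
Lemma jacobi_ratio (b c b' c' : R) (u v : {poly C}) :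
  (forall z : int, b - b' != z%:~R) \/ (forall z : int, c - c' != z%:~R) ->
  u != 0 -> v != 0 ->
  ratio_poly (pC (rho_jacobi R)) (pC (f1_jacobi b c)) (pC (f1_jacobi b' c')) u v != 0.
Proof.
case=> bc.
  apply: (@ratio_poly_root _ _ (pC (- ('X + 1))) _ _ (toC 1)).
    rewrite /rho_jacobi -map_polyC -(map_polyX toC) -rmorphB -rmorphM /=; congr pC.
    by rewrite polyC1; ring.
  move=> z; rewrite -(rmorph_int toC) !horner_map /= -rmorphM -rmorphB -rmorphD /= RtoC_eq0.
  rewrite /f1_jacobi !(hornerD, hornerN, hornerC, hornerX, hornerM).
  by have := bc (- z); rewrite rmorphN /=; apply: contra => /eqP e; apply/eqP; lra.
apply: (@ratio_poly_root _ _ (pC (1 - 'X)) _ _ (toC (-1))).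
  rewrite /rho_jacobi -map_polyC -(map_polyX toC) -rmorphB -rmorphM /=; congr pC.
  by rewrite polyCN polyC1; ring.
move=> z; rewrite -(rmorph_int toC) !horner_map /= -rmorphM -rmorphB -rmorphD /= RtoC_eq0.
rewrite /f1_jacobi !(hornerD, hornerN, hornerC, hornerX, hornerM).
by have := bc (- z); rewrite rmorphN /=; apply: contra => /eqP e; apply/eqP; lra.
Qed.

Lemma size_affine (c d : R) : (size (c%:P - d%:P * 'X)%R <= 2)%N.
Proof.
apply/leq_sizeP => -[|[|j]] // _; by rewrite coefB coefC coefCM coefX /= mulr0 subrr.
Qed.

Lemma coef_affine (c d : R) : (c%:P - d%:P * 'X)`_1 = - d.
Proof. by rewrite coefB coefC coefCM coefX /= mulr1 sub0r. Qed.

Lemma f1_laguerreE (c : R) : f1_laguerre c = (c + 1)%:P - 1%:P * 'X.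
Proof. by rewrite /f1_laguerre polyC1 mul1r. Qed.

End Conclusion.

(* Parameters are indexed 0-based: b i, al i, be i for i < N stand for the
   paper's b_{i+1}, alpha_{i+1}, beta_{i+1}; a k (1 <= k <= N-1) is a_k. *)
Theorem theorem4p3 (R : realType) (N : nat) (hN : (2 <= N)%N)
  (a : nat -> R) (ha : forall k : nat, (1 <= k <= N.-1)%N -> a k != 0) :
  (* Hermite case *)
  (forall b : nat -> R,
     (forall i j : 'I_N, i != j -> b i != b j) ->
     thm_conclusion (Amx N a) (fun i : 'I_N => w_hermite (b i)) setT
       (rho_hermite R) (fun i : 'I_N => f1_hermite (b i)) 2) /\
  (* Laguerre case *)
  (forall al : nat -> R,
     (forall i : 'I_N, -1 < al i) ->
     (forall i j : 'I_N, i != j -> forall z : int, al i - al j != z%:~R) ->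
     thm_conclusion (Amx N a) (fun i : 'I_N => w_laguerre (al i))
       [set x | 0 < x]
       (rho_laguerre R) (fun i : 'I_N => f1_laguerre (al i)) 1) /\
  (* Jacobi case *)
  (forall al be : nat -> R,
     (forall i : 'I_N, -1 < al i) -> (forall i : 'I_N, -1 < be i) ->
     (forall i j : 'I_N, i != j ->
        (forall z : int, al i - al j != z%:~R) \/
        (forall z : int, be i - be j != z%:~R)) ->
     (* alpha_1 + beta_1 = alpha_j + beta_j + 1 + (-1)^j, j = i+1 *)
     (forall i : 'I_N, al 0%N + be 0%N = al i + be i + 1 + (-1) ^+ (i.+1)) ->
     thm_conclusion (Amx N a) (fun i : 'I_N => w_jacobi (al i) (be i))
       [set x | -1 < x < 1]
       (rho_jacobi R) (fun i : 'I_N => f1_jacobi (al i) (be i)) (al 0%N + be 0%N)).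
Proof.
have N0 : (0 < N)%N by apply: leq_trans hN.
pose l0 := Ordinal N0.
split; [|split].
- move=> b hb; apply: (classical_conclusion (l0 := l0)) => //.
  + by move=> i; apply: hermite_moments.
  + exact: oner_neq0.
  + by rewrite /rho_hermite size_poly1.
  + by move=> i; apply: size_affine.
  + by move=> i j _ _; rewrite /f1_hermite !coef_affine /rho_hermite coef1 mul0rn addr0.
  + by move=> j _; rewrite /f1_hermite coef_affine subrr.
  + by move=> i j ij u v; apply: hermite_ratio; apply: hb.
  + move=> l _ _ m d V nu tE _ _.
    have c0 : RtoC (- (2 : R)) != 0 by rewrite RtoC_eq0 oppr_eq0 pnatr_eq0.
    have [q Hq] := linear_eigenvalues c0 tE; exists q => n.
    by rewrite Hq /f1_hermite !coef_map coef_affine /rho_hermite coef1 rmorph0 mul0r add0r.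
- move=> al hal hz; apply: (classical_conclusion (l0 := l0)) => //.
  + exact: exhausted_measurable (@half_line_exhausted R).
  + by move=> i; apply: laguerre_moments.
  + by rewrite polyX_eq0.
  + by rewrite /rho_laguerre size_polyX.
  + by move=> i; rewrite f1_laguerreE; apply: size_affine.
  + by move=> i j _ _; rewrite !f1_laguerreE !coef_affine /rho_laguerre coefX mul0rn addr0.
  + by move=> j _; rewrite f1_laguerreE coef_affine subrr.
  + by move=> i j ij u v; apply: laguerre_ratio; apply: hz.
  + move=> l _ _ m d V nu tE _ _.
    have c0 : RtoC (- (1 : R)) != 0 by rewrite RtoC_eq0 oppr_eq0 oner_eq0.
    have [q Hq] := linear_eigenvalues c0 tE; exists q => n.
    by rewrite Hq f1_laguerreE !coef_map coef_affine /rho_laguerre coefX rmorph0 mul0r add0r.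
move=> al be hal hbe hz hs.
have rho2 : (rho_jacobi R)`_2 = -1 by rewrite coefB coef1 coefXn sub0r.
have srho : (size (rho_jacobi R) <= 3)%N.
  rewrite (leq_trans (size_polyD _ _))// geq_max size_poly1 size_polyN size_polyXn //.
have rho1 : (rho_jacobi R).[1] = 0 by rewrite hornerD hornerN hornerXn hornerC expr1n subrr.
(* A zero-based even [i] is an odd [j = i + 1], where [1 + (-1)^j = 0]; at odd [i] the sum is
   smaller by [2]. *)
have s_even (i : 'I_N) : ~~ odd i -> al i + be i = al 0%N + be 0%N.
  by move=> oi; have := hs i; rewrite -signr_odd /= oi expr1 addrK.
have s_odd (i : 'I_N) : odd i -> al i + be i + 2 = al 0%N + be 0%N.
  by move=> oi; have := hs i; rewrite -signr_odd /= oi expr0 -addrA => ->.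
apply: (classical_conclusion (l0 := l0)) => //.
- exact: exhausted_measurable (@interval_exhausted R).
- by move=> i; apply: jacobi_moments.
- by apply/eqP => e; have := rho2; rewrite e coef0 => /eqP; rewrite eq_sym oppr_eq0 oner_eq0.
- by move=> i; apply: size_affine.
- move=> i j oi oj; rewrite !coef_affine rho2 (s_even i oi) -(s_odd j oj) mulNrn; ring.
- by move=> j oj; rewrite coef_affine (s_odd j oj) subrr.
- by move=> i j ij u v; apply: jacobi_ratio; apply: hz.
(* Here the eigenvalue at index 0 is quadratic in [n], which calls for the argument at a root of
   [rho], taken to be [1]. *)
move=> l pl nd m d V nu tE aE sV.
apply: (@root_eigenvalues _ _ _ (RtoC 1) _ _ _ _ _ m d V nu pl nd tE aE sV).
- by rewrite size_map_poly.
- by rewrite size_map_poly size_affine.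
- by rewrite horner_map /= rho1 rmorph0.
(* The quantity is [-2k - 2(alpha_1 + 1)], negative because [alpha_1 > -1]. *)
move=> k; rewrite -(rmorph_nat (@RtoC R)) deriv_map !horner_map /= -rmorphM -rmorphD /= RtoC_eq0.
rewrite /rho_jacobi derivB derivXn -[1 : {poly R}]polyC1 derivC /f1_jacobi.
rewrite !(hornerD, hornerN, hornerC, hornerX, hornerM, hornerMn, hornerXn) expr1.
have k0 : 0 <= k%:R :> R by []; have h := hal l0; rewrite /= in h.
by apply: ltr0_neq0; lra.
Qed.
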